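(* Suppose $f^i_{\mathring y_i}\colon M_i\to\mathbb R^+$, $y_i\mapsto f^i_{\mathring y_i}(y_i)$, are single-variable $C^2$ cost functions on $M_i$, $i=1,\dots,n$. For each $i$ define $\phi^i_{\mathring y_i}\colon G\times M_i\to\mathbb R^+$ by $\phi^i_{\mathring y_i}(\hat X,y_i):=f^i_{\mathring y_i}(h_i(\hat X^{-1},y_i))$, and define $\phi_{\mathring y}\colon G\times M\to\mathbb R^+$ by $\phi_{\mathring y}(\hat X,y):=\sum_{i=1}^n\phi^i_{\mathring y_i}(\hat X,y_i)$. Then: (a) The cost function $\phi_{\mathring y}$ is right invariant: $\phi_{\mathring y}(\hat XZ,h(Z,y))=\phi_{\mathring y}(\hat X,y)$ for all $\hat X,Z\in G$ and all $y\in M$. (b) Assume that each $f^i_{\mathring y_i}$, $i=1,\dots,n$, is locally positive definite around $\mathring y_i\in M_i$, and that $\bigcap_{i=1}^n\mathrm{stab}_{h_i}(\mathring y_i)=\{I\}$. Then $\phi_{\mathring y}(\cdot,\mathring y)\colon G\to\mathbb R^+$ is locally positive definite around $I\in G$. (c) If $\mathrm Df^i_{\mathring y_i}(\mathring y_i)=0$ for all $i=1,\dots,n$, then $\mathrm D_1\phi_{\mathring y}(I,\mathring y)=0$. If additionally the Hessian operators $\mathrm{Hess}f^i_{\mathring y_i}(\mathring y_i)\colon T_{\mathring y_i}M_i\to T^*_{\mathring y_i}M_i$ are symmetric positive definite for all $i=1,\dots,n$ and $\bigcap_{i=1}^nT_I\,\mathrm{stab}_{h_i}(\mathring y_i)=\{0\}$,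 then $\mathrm{Hess}_1\phi_{\mathring y}(I,\mathring y)$ is symmetric positive definite.
   Context: $G$ is a finite-dimensional real connected Lie group with Lie algebra $\mathfrak g\cong T_IG$ and identity $I$. $\mathbb R^+$ denotes the nonnegative reals. $M_1,\dots,M_n$ are homogeneous spaces of $G$, with right actions $h_i\colon G\times M_i\to M_i$, i.e. $h_i(I,y_i)=y_i$ and $h_i(XS,y_i)=h_i(S,h_i(X,y_i))$ for all $X,S\in G$, $y_i\in M_i$. Fixed reference outputs $\mathring y_i\in M_i$ are given. Put $y=(y_1,\dots,y_n)$, $\mathring y=(\mathring y_1,\dots,\mathring y_n)$, $h(X,y)=(h_1(X,y_1),\dots,h_n(X,y_n))$, and let $M=\{h(X,\mathring y):X\in G\}\subset M_1\times\dots\times M_n$ be the orbit of $\mathring y$. $\mathrm{stab}_{h_i}(\mathring y_i):=\{X\in G: h_i(X,\mathring y_i)=\mathring y_i\}$ is the stabilizer of $\mathring y_i$. A function on a manifold is locally positive definite around a point if on some neighborhood of the point it is nonnegative and vanishes exactly at that point. $\mathrm D_1$ and $\mathrm{Hess}_1$ denote the differential and Hessian with respect to the first argument; Hessians are taken at critical points, where they are intrinsically defined linear maps from the tangent space to its dual. A linear map $H\colon W\to W^*$ is symmetric positive definite if the bilinear form $(v,w)\mapsto H[v][w]$ is. *)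

(* Defs.v *)
From HB Require Import structures.
From mathcomp Require Import all_boot all_order all_algebra.
From mathcomp Require Import all_classical all_reals all_analysis.

Set Implicit Arguments.
Unset Strict Implicit.
Unset Printing Implicit Defensive.

Import Order.TTheory GRing.Theory Num.Theory.
Import numFieldNormedType.Exports.

Local Open Scope classical_set_scope.
Local Open Scope ring_scope.

(* Only used for an open [U] in a finite-dimensional [V], where continuity of *)
(* all the maps [x |-> 'd f x v] is continuity of the derivative of [f].      *)
Fixpoint Ck (R : realType) (V W : normedModType R) (k : nat) (U : set V)
    (f : V -> W) : Prop :=
  if k is k'.+1 then
    {in U, forall x, differentiable f x} /\
    forall v, Ck k' U (fun x => 'd f x v)
  else {in U, continuous f}.

Definition Cinfty (R : realType) (V W : normedModType R) (U : set V)
  (f : V -> W) : Prop := forall k, Ck k U f.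

(* [chart_map] and [chart_inv] are total functions, meaningful only on        *)
(* [chart_dom] and on [chart_map @` chart_dom], respectively.                 *)
Record chart (R : realType) (d : nat) (M : topologicalType) := Chart {
  chart_dom : set M;
  chart_map :> M -> 'rV[R]_d;
  chart_inv : 'rV[R]_d -> M;
  chart_dom_open : open chart_dom;
  chart_cod_open : open (chart_map @` chart_dom);
  chart_mapK : {in chart_dom, cancel chart_map chart_inv};
  chart_map_continuous : {in chart_dom, continuous chart_map};
  chart_inv_continuous : {in chart_map @` chart_dom, continuous chart_inv} }.

Definition chart_cod (R : realType) (d : nat) (M : topologicalType)
  (c : chart R d M) : set 'rV[R]_d := c @` chart_dom c.

HB.mixin Record isSmoothManifold (R : realType) (d : nat) M
    of Topological M := {
  atlas : set (chart R d M);
  atlas_cover : forall p : M, exists c, atlas c /\ chart_dom c p;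
  atlas_compat : forall c c', atlas c -> atlas c' ->
    Cinfty (c @` (chart_dom c `&` chart_dom c')) (c' \o chart_inv c);
  manifold_hausdorff : hausdorff_space M;
  manifold_second_countable : @second_countable M }.

#[short(type="manifoldType")]
HB.structure Definition SmoothManifold (R : realType) (d : nat) :=
  {M of isSmoothManifold R d M & Topological M}.

Section SmoothMaps.
Context {R : realType}.

Definition smooth_into (V : normedModType R) (d : nat) (N : manifoldType R d)
    (U : set V) (F : V -> N) : Prop :=
  {in U, continuous F} /\
  forall c : chart R d N, atlas c ->
    Cinfty (U `&` F @^-1` chart_dom c) (c \o F).

Definition smooth_map (a b : nat) (A : manifoldType R a) (B : manifoldType R b)
    (F : A -> B) : Prop :=
  forall c : chart R a A, atlas c ->
    smooth_into (chart_cod c) (F \o chart_inv c).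

(* Smoothness of a map on [A * B], read in the product charts.                *)
Definition smooth_map2 (a b n : nat) (A : manifoldType R a)
    (B : manifoldType R b) (N : manifoldType R n) (F : A -> B -> N) : Prop :=
  forall (c : chart R a A) (c' : chart R b B), atlas c -> atlas c' ->
    smooth_into (chart_cod c `*` chart_cod c')
      (fun u : 'rV[R]_a * 'rV[R]_b => F (chart_inv c u.1) (chart_inv c' u.2)).

Definition Ck_fun (k d : nat) (M : manifoldType R d) (f : M -> R) : Prop :=
  forall c : chart R d M, atlas c -> Ck k (chart_cod c) (f \o chart_inv c).

End SmoothMaps.

HB.mixin Record Manifold_Group_isLieGroup (R : realType) (d : nat) G
    of SmoothManifold R d G & Group G := {
  lie_mul_smooth : smooth_map2 (fun X Y : G => (X * Y)%g);
  lie_inv_smooth : smooth_map (fun X : G => (X^-1)%g) }.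

#[short(type="lieGroupType")]
HB.structure Definition LieGroup (R : realType) (d : nat) :=
  {G of Manifold_Group_isLieGroup R d G & SmoothManifold R d G & Group G}.

Section TangentSpace.
Context {R : realType} {d : nat} {M : manifoldType R d} (p : M).

Definition chart_at := {c : chart R d M | atlas c /\ chart_dom c p}.

(* A tangent vector is the family of its coordinate vectors in all the charts *)
(* around [p], which transform by the differentials of the transition maps.   *)
Definition is_tangent : pred (chart_at -> 'rV[R]_d) := fun v =>
  `[< forall c c' : chart_at,
        v c' = 'd (sval c' \o chart_inv (sval c)) (sval c p) (v c) >].

Fact is_tangent_submod_closed : submod_closed is_tangent.
Proof.
split=> [|a u v /asboolP uP /asboolP vP]; apply/asboolP => c c'.
  by rewrite linear0.
by rewrite linearP -uP -vP.
Qed.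

HB.instance Definition _ := GRing.isSubmodClosed.Build R
  (chart_at -> 'rV[R]_d) is_tangent is_tangent_submod_closed.

Record tangent := Tangent {
  tangent_coord :> chart_at -> 'rV[R]_d;
  _ : is_tangent tangent_coord }.

HB.instance Definition _ := [isSub for tangent_coord].
HB.instance Definition _ := [Choice of tangent by <:].
HB.instance Definition _ := [SubChoice_isSubLmodule of tangent by <:].

Definition some_chart : chart_at := cid (atlas_cover p).

Definition local_expr (f : M -> R) : 'rV[R]_d -> R :=
  f \o chart_inv (sval some_chart).

(* Df(p) = 0; differentiability is included because ['d] is a total operator. *)
Definition critical (f : M -> R) : Prop :=
  differentiable (local_expr f) (sval some_chart p) /\
  forall v : tangent,
    'd (local_expr f) (sval some_chart p) (v some_chart) = 0.

(* This depends on [some_chart] unless [p] is a critical point of [f].        *)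
Definition hess (f : M -> R) (v w : tangent) : R :=
  'd (fun x => 'd (local_expr f) x (v some_chart)) (sval some_chart p)
     (w some_chart).

(* The tangent space of an embedded submanifold [S] (such as a stabilizer, a  *)
(* closed subgroup), as the velocities at [p] of smooth curves lying in [S].  *)
Definition tangent_of (S : set M) : set tangent := [set v |
  exists gamma : R -> M, exists2 e : R, 0 < e &
    [/\ smooth_into `]-e, e[%classic gamma, gamma 0 = p,
        forall t, `]-e, e[%classic t -> S (gamma t) &
        forall c : chart_at, v c = 'D_1 (sval c \o gamma) 0]].

End TangentSpace.

Arguments critical {R d M} p f.
Arguments hess {R d M} p f v w.
Arguments tangent_of {R d M} p S.

(* [H] is the curried form of a linear map W -> W^*, whence the bilinearity.  *)
Definition spd (R : realType) (W : lmodType R) (H : W -> W -> R) : Prop :=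
  [/\ forall v, scalar (H v), forall w, scalar (H^~ w),
      forall v w, H v w = H w v & forall v, v != 0 -> 0 < H v v].

Definition locally_posdef (R : realType) (T : topologicalType) (f : T -> R)
    (p : T) : Prop :=
  \forall x \near p, 0 <= f x /\ (f x = 0 <-> x = p).

Section Actions.
Context {R : realType} {m d : nat} {G : lieGroupType R m}.

Definition right_homogeneous (M : manifoldType R d) (h : G -> M -> M) : Prop :=
  [/\ smooth_map2 h, forall y, h 1%g y = y,
      forall X S y, h (X * S)%g y = h S (h X y) &
      forall y z, exists X, h X y = z].

Definition stab (M : manifoldType R d) (h : G -> M -> M) (y : M) : set G :=
  [set X | h X y = y].

End Actions.

Section Cost.
Context {R : realType} {m n : nat} {d : 'I_n -> nat} {G : lieGroupType R m}
  {M : forall i, manifoldType R (d i)}.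

Definition prod_action (h : forall i, G -> M i -> M i) (X : G)
  (y : forall i, M i) : forall i, M i := fun i => h i X (y i).

Definition orbit_of (h : forall i, G -> M i -> M i) (y0 : forall i, M i) :
  set (forall i, M i) := [set prod_action h X y0 | X in [set: G]].

Definition cost1 (h : forall i, G -> M i -> M i) (f : forall i, M i -> R)
  (i : 'I_n) (X : G) (y : M i) : R := f i (h i X^-1%g y).

(* Defined on the whole product, but only meant for [y] in the orbit.         *)
Definition cost (h : forall i, G -> M i -> M i) (f : forall i, M i -> R)
  (X : G) (y : forall i, M i) : R := \sum_(i < n) cost1 h f X (y i).

End Cost.

(* Main.v *)
From HB Require Import structures.
Require Import Defs.
From mathcomp Require Import all_boot all_order all_algebra.
From mathcomp Require Import all_classical all_reals all_analysis.
From mathcomp Require Import ring lra.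

(* Since [h (X S) y = h S (h X y)], the factor [Z] cancels in (a), and near   *)
(* [1] the cost [X |-> \sum_i f_i (h_i (X^-1, y0_i))] vanishes exactly on     *)
(* the common stabilizer, which gives (b). For (c), let [g_i] be the map      *)
(* [X |-> h_i (X^-1, y0_i)] in charts; the chain rule at the critical points  *)
(* [y0_i] gives [Hess (v, w) = \sum_i Hess f_i (Dg_i v) (Dg_i w)], so it      *)
(* remains to see that [Dg_i v = 0] makes [v] tangent to the stabilizer of    *)
(* [y0_i]. Flow along the right-invariant vector field [V] with value [v] at  *)
(* [1]: by [h (Z X) y0 = h X (h Z y0)] the derivative of [X |-> h X y0] along *)
(* [V] vanishes everywhere, hence the integral curve through [1] (obtained by *)
(* Picard iteration, and smooth because [V] is) stays in the stabilizer.      *)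

Import Order.TTheory GRing.Theory Num.Theory.
Import numFieldNormedType.Exports.

Local Open Scope classical_set_scope.
Local Open Scope ring_scope.

Set Implicit Arguments.
Unset Strict Implicit.
Unset Printing Implicit Defensive.

(** * Differentials and maps of class C^k *)

(** Definiteness in (c) rests on one inclusion: the kernel of the differential of [X |-> h X^-1 y0]
    at [1] lies in the tangent space of the stabilizer. As [tangent_of] asks for smooth curves, a
    vector [v] of the kernel has to be integrated to a curve of stabilizing elements.
    [diff_inv_orbit_map_eq0] removes the inverse, [ode_exists] and [ode_Ck] give the integral curve
    of the right-invariant field through [v], and [stab_tangent] shows that the orbit map is
    constant along it. [hess_cost] writes the Hessian of the cost as the sum of the pullbacks of the
    Hessians of the [f i]; in [spd_hess_cost] a vector on which this sum vanishes lies in all the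
    kernels, hence in the intersection of the tangent spaces, which is [0]. For (b),
    [inv_orbit_continuous] carries the neighborhoods of the [y0 i] on which the [f i] are definite
    back to [1]; there a zero cost puts [X^-1] in every stabilizer. *)

Definition linear_of (R : realType) (V W : normedModType R) (f : V -> W)
    (lf : linear f) : {linear V -> W} :=
  HB.pack f (GRing.isLinear.Build R V W *:%R f lf).

Lemma linear_coord (R : realType) d (i : 'I_d) :
  linear (fun v : 'rV[R]_d => v 0 i).
Proof. by move=> a u v; rewrite !mxE. Qed.

Section Differential.
Context {R : realType}.
Implicit Types U V W : normedModType R.

(** The first-order expansion of [f] at [x] is one of [g] too, and [diff_unique] identifies its
    linear part. Every passage from one chart expression to a more convenient one rests on this. *)
Lemma near_eq_is_diff V W (f g df : V -> W) (x : V) :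
  {near x, f =1 g} -> is_diff x f df -> is_diff x g df.
Proof.
move=> fg [dfx dfE]; have fgx : f x = g x by exact: nbhs_singleton fg.
have [dfc /eqaddoP fo] := (diff_locallyP _ _).1 dfx.
have go : g \o shift x = cst (g x) + 'd f x +o_ 0 id.
  apply/eqaddoP => e e0; move/nbhs0P: fg => fg; near=> h.
  have hE : f (h + x) = g (h + x) by rewrite addrC; near: h.
  have /= : `|(f \o shift x - (cst (f x) + 'd f x)) h| <= e * `|id h|.
    by near: h; exact: fo.
  by rewrite !fctE /= hE fgx.
have dgE := diff_unique dfc go.
by split; [apply/diff_locallyP; rewrite dgE|rewrite dgE].
Unshelve. all: by end_near. Qed.

Lemma near_eq_diff V W (f g : V -> W) (x : V) :
  {near x, f =1 g} -> differentiable f x -> 'd g x = 'd f x :> (V -> W).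
Proof.
by move=> fg /differentiableP dfx; have [] := near_eq_is_diff fg dfx.
Qed.

Lemma near_eq_differentiable V W (f g : V -> W) (x : V) :
  {near x, f =1 g} -> differentiable f x -> differentiable g x.
Proof.
by move=> fg /differentiableP dfx; have [] := near_eq_is_diff fg dfx.
Qed.

Section ScaleBilinear.
Variable W : normedModType R.

Definition scaling (a : R) (w : W) : W := a *: w.

Lemma scaling_is_bilinear :
  bilinear_for
    (GRing.Scale.Law.clone _ _ *:%R _) (GRing.Scale.Law.clone _ _ *:%R _)
    scaling.
Proof.
rewrite /scaling; split=> [w|a] b x y /=; first by rewrite scalerDl scalerA.
by rewrite scalerDr !scalerA mulrC.
Qed.

HB.instance Definition _ := bilinear_isBilinear.Build R R W W _ _
  scaling scaling_is_bilinear.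

(** The product rule, as the differential of the bilinear map [scaling] composed with the pair of
    [k] and [f]. *)
Lemma is_diff_scale V (k : V -> R) (f : V -> W) x :
  differentiable k x -> differentiable f x ->
  is_diff x (fun y => k y *: f y)
    (fun v => k x *: 'd f x v + 'd k x v *: f x).
Proof.
move=> dk df; pose b : {bilinear R -> W -> W} := scaling.
have bc : continuous (fun p : R * W => b p.1 p.2) by exact: scale_continuous.
have db := differentiable_bilin (k x, f x) bc.
have dp := differentiable_pair dk df.
split.
  exact: (@differentiable_comp _ _ _ _ (fun y => (k y, f y))
    (fun p : R * W => b p.1 p.2)).
rewrite (@diff_comp _ _ _ _ (fun y => (k y, f y))
    (fun p : R * W => b p.1 p.2))//.
by rewrite (diff_bilin _ bc) (diff_pair dk df).
Qed.

End ScaleBilinear.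

Lemma diff_comp_linear V W W' (l : {linear W -> W'}) (f : V -> W) x :
  continuous l -> differentiable f x ->
  is_diff x (l \o f) (l \o 'd f x).
Proof.
move=> lc df; have dl := linear_differentiable (f x) lc.
by split; [exact: differentiable_comp|rewrite diff_comp// (diff_lin _ lc)].
Qed.

End Differential.

Section Ck.
Context {R : realType}.
Implicit Types (U V W Z : normedModType R) (k : nat).

Lemma CkS V W k (A : set V) (f : V -> W) :
  Ck k.+1 A f <-> (forall x, A x -> differentiable f x) /\
                  forall v, Ck k A (fun x => 'd f x v).
Proof.
by split=> -[df Df]; split=> // x; [move=> Ax; apply: df; rewrite inE|
  rewrite inE; exact: df].
Qed.

Lemma Ck_subset V W k (A B : set V) (f : V -> W) :
  B `<=` A -> Ck k A f -> Ck k B f.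
Proof.
move=> BA; elim: k f => [|k IH] f /=.
  by move=> cf x /set_mem/BA/mem_set/cf.
by move=> [df Df]; split=> [x /set_mem/BA/mem_set/df//|v]; exact: IH.
Qed.

(** Openness turns equality on [A] into equality near each point of [A], which passes to
    differentials. *)
Lemma Ck_eq V W k (A : set V) (f g : V -> W) : open A ->
  {in A, f =1 g} -> Ck k A f -> Ck k A g.
Proof.
move=> oA; elim: k f g => [|k IH] f g fg.
  move=> cf x xA; have /set_mem Ax := xA.
  rewrite /continuous_at -(fg x xA).
  apply: cvg_trans (cf x xA); apply: near_eq_cvg.
  by near=> y; apply/fg/mem_set; near: y; exact: open_nbhs_nbhs.
move=> /CkS[df Df].
have nfg x : A x -> {near x, f =1 g}.
  move=> Ax; near=> y; apply/fg/mem_set; near: y; exact: open_nbhs_nbhs.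
apply/CkS; split=> [x Ax|v].
  exact: near_eq_differentiable (nfg x Ax) (df x Ax).
apply: IH (Df v) => x /set_mem Ax.
by rewrite (near_eq_diff (nfg x Ax) (df x Ax)).
Unshelve. all: by end_near. Qed.

Lemma Ck_continuous V W k (A : set V) (f : V -> W) x :
  Ck k A f -> A x -> {for x, continuous f}.
Proof.
case: k => [cf|k /CkS[df _]] Ax; first exact/cf/mem_set.
exact/differentiable_continuous/df.
Qed.

Lemma CkW V W k (A : set V) (f : V -> W) : Ck k.+1 A f -> Ck k A f.
Proof.
elim: k f => [|k IH] f.
  by move=> cf x /set_mem Ax; exact: (Ck_continuous cf Ax).
by move=> /CkS[df Df]; apply/CkS; split=> // v; exact: IH.
Qed.

Lemma Ck_cst V W k (A : set V) (w : W) : Ck k A (fun=> w).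
Proof.
elim: k w => [|k IH] w; first by move=> x _; exact: cvg_cst.
apply/CkS; split=> [x _|v]; first exact: differentiable_cst.
rewrite (_ : (fun x => _) = fun=> 0); first exact: IH.
by apply/funext => x; rewrite diff_cst.
Qed.

Lemma Ck_linear V W W' k (A : set V) (l : {linear W -> W'}) (f : V -> W) :
  open A -> continuous l -> Ck k A f -> Ck k A (l \o f).
Proof.
move=> oA lc; elim: k f => [|k IH] f.
  by move=> cf x /cf fx; exact: continuous_comp fx (lc _).
move=> /CkS[df Df]; apply/CkS; split=> [x Ax|v].
  by have [] := diff_comp_linear lc (df x Ax).
apply: Ck_eq (IH _ (Df v)) => // x /set_mem Ax /=.
by have [_ ->] := diff_comp_linear lc (df x Ax).
Qed.

Lemma Ck_linear_fun V W k (A : set V) (l : {linear V -> W}) :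
  continuous l -> Ck k A l.
Proof.
move=> lc; case: k => [|k]; first by move=> x _; exact: lc.
apply/CkS; split=> [x _|v]; first exact: linear_differentiable.
rewrite (_ : (fun x => _) = fun=> l v); first exact: Ck_cst.
by apply/funext => x; rewrite (diff_lin x lc).
Qed.

Lemma CkD V W k (A : set V) (f g : V -> W) : open A ->
  Ck k A f -> Ck k A g -> Ck k A (fun x => f x + g x).
Proof.
move=> oA; elim: k f g => [|k IH] f g.
  by move=> cf cg x xA; exact: (cvgD (cf x xA) (cg x xA)).
move=> /CkS[df Df] /CkS[dg Dg]; apply/CkS; split=> [x Ax|v].
  exact: differentiableD (df x Ax) (dg x Ax).
apply: Ck_eq (IH _ _ (Df v) (Dg v)) => // x /set_mem Ax.
have := congr1 (fun h : V -> W => h v) (diffD (df x Ax) (dg x Ax)).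
by rewrite fctE => E; exact: (esym E).
Qed.

Lemma Ck_sum V W k (A : set V) (I : Type) (s : seq I) (f : I -> V -> W) :
  open A -> (forall i, Ck k A (f i)) -> Ck k A (fun x => \sum_(i <- s) f i x).
Proof.
move=> oA cf; elim: s => [|i s IH].
  by under eq_fun do rewrite big_nil; exact: Ck_cst.
by under eq_fun do rewrite big_cons; exact: CkD.
Qed.

Lemma Ck_scale V W k (A : set V) (a : V -> R) (f : V -> W) : open A ->
  Ck k A a -> Ck k A f -> Ck k A (fun x => a x *: f x).
Proof.
move=> oA; elim: k a f => [|k IH] a f.
  by move=> ca cf x xA; exact: (cvgZ (ca x xA) (cf x xA)).
move=> Ca Cf; have [[da Da] [df Df]] := ((CkS _ _ _).1 Ca, (CkS _ _ _).1 Cf).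
apply/CkS; split=> [x Ax|v].
  by have [] := is_diff_scale (da x Ax) (df x Ax).
apply: (@Ck_eq _ _ _ _ (fun x => a x *: 'd f x v + 'd a x v *: f x)) => //.
  by move=> x /set_mem Ax; have [_ ->] := is_diff_scale (da x Ax) (df x Ax).
by apply: CkD => //; apply: IH => //; exact: CkW.
Qed.

(** Finite dimension in the form used by [Ck_comp], stated abstractly so as to cover row vectors and
    their products alike. *)
Definition has_finite_basis V := exists (I : finType) (e : I -> V)
  (c : I -> {linear V -> R}),
  (forall i, continuous (c i)) /\ forall v, v = \sum_i c i v *: e i.

Lemma has_finite_basis_rV d : has_finite_basis 'rV[R]_d.
Proof.
exists 'I_d, (delta_mx 0), (fun i => linear_of (linear_coord (R := R) i)).
by split=> [i|v]; [exact: coord_continuous|exact: row_sum_delta].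
Qed.

Lemma has_finite_basis_prod V W :
  has_finite_basis V -> has_finite_basis W -> has_finite_basis (V * W)%type.
Proof.
move=> [I [e [c [cc vE]]]] [J [e' [c' [cc' wE]]]].
have l1 i : linear (fun p : V * W => c i p.1).
  by move=> a u v; rewrite linearP.
have l2 i : linear (fun p : V * W => c' i p.2).
  by move=> a u v; rewrite linearP.
exists (I + J)%type,
  (fun k : (I + J)%type => match k with inl i => (e i, 0)
                                   | inr j => (0, e' j) end),
  (fun k : (I + J)%type => match k with inl i => linear_of (l1 i)
                       | inr j => linear_of (l2 j) end).
split=> [[i|j] /= p|[v w]].
- exact: continuous_comp (@cvg_fst _ _ _ _ _) (cc i _).
- exact: continuous_comp (@cvg_snd _ _ _ _ _) (cc' j _).
rewrite big_sumType /=; apply: injective_projections => /=.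
  rewrite [in LHS](vE v) !raddf_sum /= [X in _ + X]big1 ?addr0// => i _.
  by rewrite scaler0.
rewrite [in LHS](wE w) !raddf_sum /= [X in X + _]big1 ?add0r// => i _.
by rewrite scaler0.
Qed.

(* ['d (f \o g) x v] is expanded along a basis of [V], because [Ck] only      *)
(* speaks of derivatives in constant directions.                              *)
Lemma Ck_comp Z V W k (A : set Z) (B : set V) (f : V -> W) (g : Z -> V) :
  has_finite_basis V -> open A -> (forall x, A x -> B (g x)) ->
  Ck k A g -> Ck k B f -> Ck k A (f \o g).
Proof.
move=> [I [e [c [cc vE]]]] oA AB; elim: k f g AB => [|k IH] f g AB.
  move=> cg cf x xA; apply: continuous_comp (cg x xA) (cf _ _).
  exact/mem_set/AB/set_mem.
move=> Cg Cf; have [[dg Dg] [df Df]] := ((CkS _ _ _).1 Cg, (CkS _ _ _).1 Cf).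
apply/CkS; split=> [x Ax|v].
  exact: differentiable_comp (dg x Ax) (df _ (AB x Ax)).
apply: (@Ck_eq _ _ _ _
  (fun x => \sum_i c i ('d g x v) *: 'd f (g x) (e i))) => //.
  move=> x /set_mem Ax.
  rewrite (diff_comp (dg x Ax) (df _ (AB x Ax))) /=.
  rewrite [in RHS](vE ('d g x v)) linear_sum.
  by apply: eq_bigr => i _; rewrite linearZ.
apply: Ck_sum => // i; apply: Ck_scale => //.
  exact: Ck_linear oA (cc i) (Dg v).
(* Here [g] occurs undifferentiated, next to a derivative of [f], so its order is merely weakened to
   [k]. *)
exact: IH AB (CkW Cg) (Df _).
Qed.

Lemma Ck_pair V W Z k (A : set Z) (f : Z -> V) (g : Z -> W) : open A ->
  Ck k A f -> Ck k A g -> Ck k A (fun x => (f x, g x)).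
Proof.
move=> oA; elim: k f g => [|k IH] f g.
  by move=> cf cg x xA; exact: (cvg_pair (cf x xA) (cg x xA)).
move=> /CkS[df Df] /CkS[dg Dg]; apply/CkS; split=> [x Ax|v].
  exact: differentiable_pair (df x Ax) (dg x Ax).
apply: Ck_eq (IH _ _ (Df v) (Dg v)) => // x /set_mem Ax.
by rewrite (diff_pair (df x Ax) (dg x Ax)).
Qed.

End Ck.

(** * Ordinary differential equations *)

Section ODE.
Context {R : realType}.

(** Row vectors carry the sup norm; [0 <= K] covers [d = 0], where there is no coordinate to
    bound. *)
Lemma rV_norm_le d (v : 'rV[R]_d) (K : R) : 0 <= K ->
  (`|v| <= K) = [forall i, `|v 0 i| <= K].
Proof.
move=> K0; rewrite [`|v|]mx_normrE; apply/idP/forallP => [vK i|vK].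
  by apply: le_trans vK; exact: (le_bigmax _ (fun ij => `|v ij.1 ij.2|) (0, i)).
by apply: bigmax_le => // -[i j] _; rewrite (ord1 i); exact: vK.
Qed.

Lemma coord_norm_le d (v : 'rV[R]_d) i : `|v 0 i| <= `|v|.
Proof. by have := lexx `|v|; rewrite {1}rV_norm_le// => /forallP. Qed.

Lemma MVT_norm_le (F f : R -> R) (a b K : R) :
  (forall x, x \in `[Num.min a b, Num.max a b] -> is_derive x 1 F (f x)) ->
  (forall x, x \in `[Num.min a b, Num.max a b] -> `|f x| <= K) ->
  `|F b - F a| <= K * `|b - a|.
Proof.
wlog ab : a b / a <= b => [H|].
  move=> dF fK; have [ab|/ltW ba] := leP a b; first exact: H.
  have := H b a ba; rewrite (minC b a) (maxC b a).
  by rewrite -(opprB (F a)) -(opprB a b) !normrN; apply.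
rewrite min_l// max_r// => dF fK.
have cF : {within `[a, b], continuous F}.
  by apply: derivable_within_continuous => x /dF[].
have [c cab ->] := MVT_segment ab
  (fun x xab => dF x (subset_itv_oo_cc xab)) cF.
by rewrite normrM ler_wpM2r// fK.
Qed.

(** No single intermediate point serves all coordinates, but in the sup norm the inequality follows
    coordinatewise with the same constant. *)
Lemma MVT_norm_le_rV d (F f : R -> 'rV[R]_d) (a b K : R) : 0 <= K ->
  (forall x, x \in `[Num.min a b, Num.max a b] -> is_derive x 1 F (f x)) ->
  (forall x, x \in `[Num.min a b, Num.max a b] -> `|f x| <= K) ->
  `|F b - F a| <= K * `|b - a|.
Proof.
move=> K0 dF fK; rewrite rV_norm_le; last by rewrite mulr_ge0.
apply/forallP => i; rewrite !mxE.
apply: (@MVT_norm_le (fun x => F x 0 i) (fun x => f x 0 i)) => x xab.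
  have [dFx <-] := dF x xab; rewrite derive_mx// mxE.
  by apply: derivableP; exact: (derivable_mxP _ _ _).1.
exact: le_trans (coord_norm_le _ _) (fK x xab).
Qed.

(** The integral from [-1], shifted to vanish at [0], treats positive and negative times at once;
    hence the interval []-1, 1[]. *)
Lemma antiderivative (g : R -> R) : continuous g ->
  exists G : R -> R, G 0 = 0 /\
    forall t : R, t \in `]-1, 1[%R -> is_derive t 1 G (g t).
Proof.
move=> cg.
have ig : (@lebesgue_measure R).-integrable `[-1, 1] (EFin \o g).
  apply: continuous_compact_integrable; first exact: segment_compact.
  exact: continuous_subspaceT.
pose F (x : R) := (\int[lebesgue_measure]_(t in `[-1, x]) g t)%R.
exists (fun x => F x - F 0); split; first by rewrite subrr.
move=> t; rewrite in_itv/= => /andP[t1 t2].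
have [dF FE] := continuous_FTC1_closed t2 ig t1 (cg t).
rewrite -[g t]subr0; apply: is_deriveB.
by rewrite -FE derive1E; exact: derivableP.
Qed.

Lemma antiderivative_rV d (g : R -> 'rV[R]_d) : continuous g ->
  exists G : R -> 'rV[R]_d, G 0 = 0 /\
    forall t : R, t \in `]-1, 1[%R -> is_derive t 1 G (g t).
Proof.
move=> cg.
have cgi i : continuous (fun t => g t 0 i).
  move=> t; apply: (@continuous_comp _ _ _ g (fun v : 'rV[R]_d => v 0 i)).
    exact: cg.
  exact: coord_continuous.
have [G GP] := choice (fun i => antiderivative (cgi i)).
exists (fun t => \row_i G i t); split=> [|t t1].
  by apply/rowP => i; rewrite !mxE; case: (GP i).
have dG : derivable (fun t => \row_i G i t) t 1.
  apply/derivable_mxP => i j; rewrite (_ : (fun x => _) = G j).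
    by have [_ /(_ t t1)[]] := GP j.
  by apply/funext => x; rewrite mxE.
apply: DeriveDef => //; rewrite derive_mx//; apply/rowP => j; rewrite mxE.
rewrite (_ : (fun x => _) = G j); first by have [_ /(_ t t1)[]] := GP j.
by apply/funext => x; rewrite mxE.
Qed.

Lemma lipschitz_continuous (V W : normedModType R) (f : V -> W) (L : R) :
  (forall x y, `|f x - f y| <= L * `|x - y|) -> continuous f.
Proof.
move=> fL x; apply/cvgrPdist_le => e e0.
(* [L] has no prescribed sign and may be [0]; this larger constant can be divided by. *)
have L1 : 0 < `|L| + 1 by rewrite ltr_wpDl.
near=> y; apply: le_trans (fL _ _) _.
apply: (@le_trans _ _ ((`|L| + 1) * `|x - y|)).
  by rewrite ler_wpM2r// (le_trans (ler_norm L))// lerDl.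
rewrite -ler_pdivlMl//; near: y.
by apply: cvgr_dist_le; [exact: cvg_id|rewrite mulr_gt0// invr_gt0].
Unshelve. all: by end_near. Qed.

(* Clamping a vector field coordinatewise makes it globally Lipschitz, and     *)
(* clamping the time keeps the Picard iterates where [antiderivative] applies. *)
Definition clamp (a r t : R) : R := Num.max (a - r) (Num.min (a + r) t).

Lemma clamp_in a r t : 0 <= r -> `|clamp a r t - a| <= r.
Proof.
by move=> r0; rewrite ler_norml /clamp maxEle minEle; do 2?case: ifP; lra.
Qed.

Lemma clamp_id a r t : `|t - a| <= r -> clamp a r t = t.
Proof.
rewrite ler_norml => /andP[h1 h2]; rewrite /clamp maxEle minEle.
by case: ifP; case: ifP; lra.
Qed.

Lemma clamp_lipschitz a r s t : 0 <= r ->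
  `|clamp a r s - clamp a r t| <= `|s - t|.
Proof.
move=> r0; wlog st : s t / s <= t => [H|].
  have [st|/ltW ts] := leP s t; first exact: H.
  by have := H t s ts; rewrite -(opprB s t) -(opprB (clamp a r s)) !normrN.
rewrite (ler0_norm (_ : s - t <= 0)); last by lra.
rewrite ler_norml /clamp !maxEle !minEle.
by apply/andP; split; do 4?case: ifP; lra.
Qed.

End ODE.

(** * Picard iteration for a globally Lipschitz vector field *)

Section Picard.
Context {R : realType} {d : nat}.
Variables (W : 'rV[R]_d -> 'rV[R]_d) (L : R).
Hypothesis L_ge0 : 0 <= L.
Hypothesis W_lip : forall x y, `|W x - W y| <= L * `|x - y|.

(** A time span for which a Picard step contracts by [L * e <= 1/2] and times stay in []-1, 1[],
    also when [L = 0]. *)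
Let e : R := (2 * (L + 1))^-1.

Let e_gt0 : 0 < e.
Proof. by rewrite invr_gt0 mulr_gt0// ltr_wpDl. Qed.

Let Le : L * e <= 2^-1.
Proof.
by rewrite /e invfM mulrCA ger_pMr// ler_pdivrMr ?ltr_wpDl// mul1r lerDl.
Qed.

Let e_lt1 : e < 1.
Proof. by rewrite invf_lt1 ?mulr_gt0 ?ltr_wpDl//; move: L_ge0; lra. Qed.

Let clamp01 (t : R) : clamp 0 e t \in `]-1, 1[%R.
Proof.
have := clamp_in 0 t (ltW e_gt0); rewrite subr0 ler_norml => /andP[h1 h2].
by rewrite in_itv /=; apply/andP; split; move: e_lt1; lra.
Qed.

(** The operator [P] adds to [x0] the integral of [W \o u] from [0] to the clamped time. It halves
    uniform distances, so its iterates converge uniformly to a continuous fixed point, and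
    differentiating [P u = u] gives the equation. *)
Lemma picard (x0 : 'rV[R]_d) : exists2 r : R, 0 < r & exists u : R -> 'rV[R]_d,
  u 0 = x0 /\ forall t : R, `|t| < r -> is_derive t 1 u (W (u t)).
Proof.
have cW : continuous W := lipschitz_continuous W_lip.
have /choice[A AP] (g : R -> 'rV[R]_d) : exists G : R -> 'rV[R]_d,
    continuous g -> G 0 = 0 /\
    forall t : R, t \in `]-1, 1[%R -> is_derive t 1 G (g t).
  (* A discontinuous [g] gets a dummy value, so that [A] is a total operator. *)
  have [cg|ncg] := pselect (continuous g); last by exists g.
  by have [G GP] := antiderivative_rV cg; exists G.
pose P u t := x0 + A (W \o u) (clamp 0 e t).
have cWu (u : R -> 'rV[R]_d) : continuous u -> continuous (W \o u).
  by move=> cu t; apply: continuous_comp; [exact: cu|exact: cW].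
have ccl : continuous (clamp (0 : R) e).
  apply: (@lipschitz_continuous _ _ _ _ 1) => s t.
  by rewrite mul1r clamp_lipschitz// ltW.
have cP u : continuous u -> continuous (P u).
  move=> cu t; apply: (@cvgD _ _ _ _ _ (fun=> x0)); first exact: cvg_cst.
  apply: (@continuous_comp _ _ _ (clamp 0 e) (A (W \o u))); first exact: ccl.
  have [_ /(_ _ (clamp01 t))[dA _]] := AP _ (cWu _ cu).
  exact/differentiable_continuous/derivable1_diffP.
pose I (t : R) := `[Num.min 0 (clamp 0 e t), Num.max 0 (clamp 0 e t)].
have clt (t x : R) : x \in I t ->
    x \in `]-1, 1[%R.
  have := clamp01 t; rewrite /I !in_itv/= => /andP[h1 h2] /andP[].
  by rewrite minEle maxEle; case: ifP => _ h3 h4; lra.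
have cle (t : R) : `|clamp 0 e t - 0| <= e by rewrite clamp_in// ltW.
have Pcontr u v K : 0 <= K -> continuous u -> continuous v ->
    (forall s, `|u s - v s| <= K) -> forall t, `|P u t - P v t| <= K / 2.
  move=> K0 cu cv uvK t; rewrite /P opprD addrACA subrr add0r.
  have [Au0 dAu] := AP _ (cWu _ cu); have [Av0 dAv] := AP _ (cWu _ cv).
  have dF (x : R) : x \in I t ->
      is_derive x 1 (fun s => A (W \o u) s - A (W \o v) s) (W (u x) - W (v x)).
    by move=> /clt x1; apply: is_deriveB; [exact: dAu|exact: dAv].
  have dFle (x : R) : x \in I t ->
      `|W (u x) - W (v x)| <= L * K.
    by move=> _; apply: le_trans (W_lip _ _) _; rewrite ler_wpM2l.
  have := MVT_norm_le_rV (mulr_ge0 L_ge0 K0) dF dFle.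
  rewrite Au0 Av0 subrr subr0 => /le_trans; apply.
  rewrite mulrAC [K / 2]mulrC ler_wpM2r//; apply: le_trans Le.
  by rewrite ler_wpM2l.
pose u_ n := iter n P (fun=> x0).
have cu_ n : continuous (u_ n).
  by elim: n => [|n IH] /=; [move=> t; exact: cvg_cst|exact: cP].
(* Bounds the first step: along the constant curve [x0] the field is constantly [W x0], for a time
   at most [e]. *)
pose C := `|W x0| * e.
have C0 : 0 <= C by rewrite mulr_ge0// ltW.
have step n : forall t, `|u_ n.+1 t - u_ n t| <= C * 2^-1 ^+ n.
  elim: n => [|n IH] t; last first.
    rewrite exprSr mulrA; apply: Pcontr (cu_ _) (cu_ _) IH _.
    by rewrite mulr_ge0// exprn_ge0// invr_ge0.
  rewrite expr0 mulr1 /= /P addrC addKr.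
  have [A0 dA] := AP _ (cWu _ (cu_ 0%N)).
  have dA0 (x : R) : x \in I t ->
      is_derive x 1 (A (W \o u_ 0%N)) (W x0).
    by move=> /clt; exact: dA.
  have := MVT_norm_le_rV (normr_ge0 (W x0)) dA0 (fun _ _ => lexx _).
  by rewrite A0 subr0 => /le_trans; apply; rewrite ler_wpM2l.
(* The tail of the geometric series of the bounds in [step], from index [n] on; the sum of finitely
   many of them is a difference of two tails. *)
pose D n := 2 * C * 2^-1 ^+ n.
have D0 n : 0 <= D n.
  by apply: mulr_ge0; [exact: mulr_ge0|rewrite exprn_ge0// invr_ge0].
have DS n : D n.+1 = D n / 2 by rewrite /D exprSr mulrA.
have u_le n k t : `|u_ (n + k)%N t - u_ n t| <= D n - D (n + k)%N.
  elim: k => [|k IH]; first by rewrite addn0 !subrr normr0.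
  rewrite addnS DS -(subrKA (u_ (n + k)%N t)).
  apply: le_trans (ler_normD _ _) _.
  have -> : D n - D (n + k)%N / 2 =
    C * 2^-1 ^+ (n + k)%N + (D n - D (n + k)%N) by rewrite {2 4}/D; lra.
  by rewrite lerD// step.
have u_leD n k t : `|u_ (n + k)%N t - u_ n t| <= D n.
  by apply: le_trans (u_le n k t) _; rewrite gerBl.
have cvgD0 : D @ \oo --> (0 : R).
  rewrite -(mulr0 (2 * C)); apply: cvgM; first exact: cvg_cst.
  by apply: cvg_expr; rewrite gtr0_norm ?invr_gt0// invf_lt1// ltr1n.
have D_lt (q : R) : 0 < q -> exists n, D n <= q.
  move=> q0; have /cvgrPdist_le/(_ q q0)[n _ /(_ n (leqnn n))] := cvgD0.
  by rewrite sub0r normrN ger0_norm//; exists n.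
have cvgu t : cvg (u_ n t @[n --> \oo]).
  apply/cauchy_cvgP/cauchy_exP => q q0.
  have [n Dn] := D_lt (q / 2) (divr_gt0 q0 (ltr0Sn _ _)).
  exists (u_ n t); exists n => // k /= nk.
  rewrite -ball_normE /= -(subnKC nk) -opprB normrN.
  by apply: le_lt_trans (u_leD _ _ _) _; apply: le_lt_trans Dn _; move: q0; lra.
pose u t := lim (u_ n t @[n --> \oo]).
have uu_ n t : `|u t - u_ n t| <= D n.
  apply/ler_addgt0Pl => q q0.
  have /cvgrPdist_le/(_ q q0)[k _ kP] := cvgu t.
  rewrite -(subrKA (u_ (n + k)%N t)); apply: le_trans (ler_normD _ _) _.
  by rewrite lerD// kP//= leq_addl.
(* A uniform limit of continuous curves, with [q] split in three. *)
have cu : continuous u.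
  move=> t; apply/cvgrPdist_le => q q0.
  have q3 : 0 < q / 3 by rewrite divr_gt0.
  have [n Dn] := D_lt _ q3.
  near=> s; rewrite -(subrKA (u_ n t)) -[u_ n t - u s](subrKA (u_ n s)).
  have -> : q = q / 3 + (q / 3 + q / 3) by lra.
  apply: le_trans (ler_normD _ _) _; apply: lerD.
    exact: le_trans (uu_ _ _) Dn.
  apply: le_trans (ler_normD _ _) _; apply: lerD.
    near: s; have /cvgrPdist_le/(_ _ q3) := cu_ n t; exact.
  by rewrite -opprB normrN; exact: le_trans (uu_ _ _) Dn.
(* Both [P u] and [u] are close to [P (u_ n) = u_ n.+1], within [D n / 2] and [D n.+1]. *)
have Pu t : P u t = u t.
  apply/eqP; rewrite -subr_eq0 -normr_le0.
  apply/ler_addgt0Pl => q q0; rewrite addr0.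
  have [n Dn] := D_lt _ q0; apply: le_trans Dn.
  rewrite -(subrKA (P (u_ n) t)); apply: le_trans (ler_normD _ _) _.
  have -> : D n = D n / 2 + D n.+1 by rewrite DS; lra.
  apply: lerD; first exact: Pcontr (D0 n) cu (cu_ n) (uu_ n) t.
  by rewrite -opprB normrN; exact: (uu_ n.+1 t).
have [A0 dA] := AP _ (cWu _ cu).
exists e => //; exists u; split=> [|t te].
  by rewrite -Pu /P clamp_id ?subrr ?normr0 ?ltW// A0 addr0.
have t1 : t \in `]-1, 1[%R.
  by rewrite in_itv /= -ltr_norml (lt_trans te).
have dut : is_derive t 1 (fun t => x0 + A (W \o u) t) (W (u t)).
  by rewrite -[W (u t)]add0r; apply: is_deriveD; exact: dA.
(* Near a [t] with [|t| < e] the clamp is the identity, so [u] is there the unclamped integral. *)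
apply: near_eq_is_derive dut.
near=> s; rewrite -Pu /P clamp_id// subr0 ltW//; near: s.
have := (@norm_continuous _ _ t); move/cvgr_lt; exact.
Unshelve. all: by end_near. Qed.

End Picard.

(** * Local existence and smoothness of integral curves *)

Section LocalODE.
Context {R : realType}.

Lemma is_derive_comp_diff (V W : normedModType R) (g : R -> V) (f : V -> W)
    (t : R) (dg : V) :
  is_derive t 1 g dg -> differentiable f (g t) ->
  is_derive t 1 (f \o g) ('d f (g t) dg).
Proof.
move=> [/derivable1_diffP dgt <-] df.
have dfg : differentiable (f \o g) t by exact: differentiable_comp.
apply: DeriveDef; first exact/derivable1_diffP.
by rewrite (deriveE _ dfg) (deriveE _ dgt) (diff_comp dgt df).
Qed.

Lemma is_derive_scalel (V : normedModType R) (v : V) (s : R) :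
  is_derive s 1 (fun t : R => t *: v) v.
Proof.
have [ds dsE] := @is_diff_scalel R V s v.
apply: DeriveDef; first exact/derivable1_diffP.
apply: (etrans (@deriveE R R V (fun t : R => t *: v) s 1 ds)).
apply: (etrans (congr1 (fun l : R -> V => l 1) dsE)).
exact: scale1r.
Qed.

(** Near [x0] each partial derivative is at most its size at [x0] plus [1]; the mean value
    inequality along a segment, which stays in the ball by convexity, adds these bounds. Validity
    for all small [r] lets several functions share one radius. *)
Lemma Ck1_lipschitz d (f : 'rV[R]_d -> R) (A : set 'rV[R]_d) (x0 : 'rV[R]_d) :
  open A -> A x0 -> Ck 1 A f -> exists L : R, 0 <= L /\
  \forall r \near 0^'+, forall x y, `|x - x0| <= r -> `|y - x0| <= r ->
    `|f x - f y| <= L * `|x - y|.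
Proof.
move=> oA Ax0 /CkS[df Df].
pose b (i : 'I_d) : R := `|'d f x0 (delta_mx 0 i)| + 1.
have b0 i : 0 <= b i by rewrite addr_ge0.
exists (\sum_i b i); split; first exact: sumr_ge0.
have : \forall x \near x0, A x /\ forall i, `|'d f x (delta_mx 0 i)| <= b i.
  near=> x; split; first by near: x; exact: open_nbhs_nbhs.
  near: x; apply: filter_forall => i.
  have /cvgrPdist_le/(_ 1 ltr01) := Ck_continuous (Df (delta_mx 0 i)) Ax0.
  apply: filterS => x; rewrite /b => dx1; rewrite -lerBlDl.
  by apply: le_trans dx1; rewrite distrC lerB_dist.
move=> /nbhs_closedballP[r0 r0P].
near=> r => x y xr yr.
have cr z : `|z - x0| <= r -> A z /\ forall i, `|'d f z (delta_mx 0 i)| <= b i.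
  move=> zr; apply: r0P; rewrite closed_ballE// /closed_ball_ /= distrC.
  by apply: le_trans zr _; near: r; exact: nbhs_right_le.
pose g (s : R) := y + s *: (x - y).
have gr (s : R) : s \in `[Num.min 0 1, Num.max 0 1] -> `|g s - x0| <= r.
  rewrite min_l// max_r// in_itv /= => /andP[s0 s1].
  have -> : g s - x0 = (1 - s) *: (y - x0) + s *: (x - x0).
    by apply/rowP => i; rewrite !mxE; ring.
  apply: le_trans (ler_normD _ _) _; rewrite !normrZ.
  rewrite (ger0_norm s0) ger0_norm ?subr_ge0//.
  have -> : r = (1 - s) * r + s * r by ring.
  by apply: lerD; apply: ler_wpM2l; rewrite ?subr_ge0.
have dg (s : R) : is_derive s 1 g (x - y).
  have := is_deriveD (is_derive_cst y s 1) (is_derive_scalel (x - y) s).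
  by rewrite add0r.
have dfg (s : R) : s \in `[Num.min 0 1, Num.max 0 1] ->
    is_derive s 1 (f \o g) ('d f (g s) (x - y)).
  by move=> /gr/cr[As _]; apply: is_derive_comp_diff (df _ As); exact: dg.
have dfgb (s : R) : s \in `[Num.min 0 1, Num.max 0 1] ->
    `|'d f (g s) (x - y)| <= (\sum_i b i) * `|x - y|.
  move=> /gr/cr[_ bs]; rewrite [in leLHS](row_sum_delta (x - y)) linear_sum.
  rewrite mulr_suml; apply: le_trans (ler_norm_sum _ _ _) _.
  apply: ler_sum => i _; rewrite linearZ normrZ mulrC.
  by apply: ler_pM => //; exact: coord_norm_le.
have := MVT_norm_le dfg dfgb.
by rewrite /= /g scale1r scale0r addr0 (addrC y) subrK subr0 normr1 mulr1.
Unshelve. all: by end_near. Qed.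

(** Composing [V] with the retraction [p] onto a small cube around [x0], which is 1-Lipschitz in the
    sup norm, gives a globally Lipschitz field for [picard]. By continuity the solution stays in the
    cube for a short time, and there [p] is the identity. *)
Lemma ode_exists d (V : 'rV[R]_d -> 'rV[R]_d) (A : set 'rV[R]_d)
    (x0 : 'rV[R]_d) : open A -> A x0 -> Ck 1 A V ->
  exists2 r : R, 0 < r & exists u : R -> 'rV[R]_d, u 0 = x0 /\
    forall t : R, `|t| < r -> A (u t) /\ is_derive t 1 u (V (u t)).
Proof.
move=> oA Ax0 CV.
have CVi i : Ck 1 A (fun x => V x 0 i).
  apply: (Ck_linear oA (_ : continuous (linear_of (linear_coord i))) CV).
  exact: coord_continuous.
have [L LP] := choice (fun i => Ck1_lipschitz oA Ax0 (CVi i)).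
have [r r0 [rA rL]] : exists2 r : R, 0 < r &
    (forall x, `|x - x0| <= r -> A x) /\
    forall i x y, `|x - x0| <= r -> `|y - x0| <= r ->
      `|V x 0 i - V y 0 i| <= L i * `|x - y|.
  have /nbhs_closedballP[r1 r1A] : nbhs x0 A by exact: open_nbhs_nbhs.
  near (0 : R)^'+ => r; exists r => //; split=> [x xr|].
    apply: r1A; rewrite closed_ballE// /closed_ball_ /= distrC.
    by apply: le_trans xr _; near: r; exact: nbhs_right_le.
  near: r; apply: filter_forall => i; exact: (LP i).2.
pose p (x : 'rV[R]_d) : 'rV[R]_d := \row_i clamp (x0 0 i) r (x 0 i).
have pr x : `|p x - x0| <= r.
  rewrite rV_norm_le ?ltW//; apply/forallP => i; rewrite !mxE.
  exact/clamp_in/ltW.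
have p_id x : `|x - x0| <= r -> p x = x.
  rewrite rV_norm_le ?ltW// => /forallP xr; apply/rowP => i; rewrite mxE.
  by apply: clamp_id; have := xr i; rewrite !mxE.
have p_lip x y : `|p x - p y| <= `|x - y|.
  rewrite rV_norm_le//; apply/forallP => i; rewrite !mxE.
  apply: le_trans (clamp_lipschitz _ _ _ (ltW r0)) _.
  by have := coord_norm_le (x - y) i; rewrite !mxE.
have L0 : 0 <= \sum_i L i by apply: sumr_ge0 => i _; exact: (LP i).1.
have V_lip x y : `|(V \o p) x - (V \o p) y| <= (\sum_i L i) * `|x - y|.
  rewrite rV_norm_le ?mulr_ge0//; apply/forallP => i; rewrite !mxE /=.
  apply: le_trans (rL i _ _ (pr x) (pr y)) _; apply: ler_pM => //.
    exact: (LP i).1.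
  rewrite (bigD1 i)//= lerDl; apply: sumr_ge0 => j _; exact: (LP j).1.
have [e e0 [u [u0 du]]] := picard L0 V_lip x0.
have cu : {for 0, continuous u}.
  have e0' : `|0 : R| < e by rewrite normr0.
  have [du0 _] := du 0 e0'.
  exact/differentiable_continuous/derivable1_diffP.
have /nbhs_ballP[q /= q0 qP] : \forall t \near (0 : R), `|u t - x0| <= r.
  have /cvgrPdist_le/(_ r r0) := cu; rewrite u0; apply: filterS => t.
  by rewrite distrC.
exists (Num.min e q); first by rewrite lt_min e0.
exists u; split=> // t; rewrite lt_min => /andP[te tq].
have utr : `|u t - x0| <= r.
  by apply: qP; rewrite -ball_normE /= sub0r normrN.
split; first exact: rA.
by have := du t te; rewrite /= p_id.
Unshelve. all: by end_near. Qed.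

(** Bootstrapping: if [u] is of class C^k, then so is its derivative [V \o u], and [u] gains one
    order. *)
Lemma ode_Ck d (V : 'rV[R]_d -> 'rV[R]_d) (A : set 'rV[R]_d) (B : set R)
    (u : R -> 'rV[R]_d) k : open A -> open B -> Ck k A V ->
  (forall t, B t -> A (u t) /\ is_derive t 1 u (V (u t))) -> Ck k B u.
Proof.
move=> oA oB; elim: k => [|k IH] CV uP.
  move=> t /set_mem/uP[_ [dut _]].
  exact/differentiable_continuous/derivable1_diffP.
apply/CkS; split=> [t /uP[_ [dut _]]|s]; first exact/derivable1_diffP.
have CVu : Ck k B (V \o u).
  apply: Ck_comp (has_finite_basis_rV _) oB _ (IH (CkW CV) uP) (CkW CV).
  by move=> t /uP[].
have := Ck_scale oB (Ck_cst k B s) CVu.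
apply: Ck_eq => // t /set_mem/uP[_ [/derivable1_diffP dut duE]].
by rewrite /= -duE (deriveE _ dut) -linearZ /= [s *: 1]mulr1.
Qed.

End LocalODE.

(** * Chain rules *)

Section SecondOrder.
Context {R : realType}.

Lemma is_diff_bigsum (V W : normedModType R) (I : Type) (s : seq I)
    (f df : I -> V -> W) (x : V) :
  (forall i, is_diff x (f i) (df i)) ->
  is_diff x (fun y => \sum_(i <- s) f i y) (fun v => \sum_(i <- s) df i v).
Proof.
move=> fdf; elim: s => [|i s IH].
  under eq_fun do rewrite big_nil.
  under [X in is_diff_def _ _ X]eq_fun do rewrite big_nil.
  exact: is_diff_cst.
under eq_fun do rewrite big_cons.
under [X in is_diff_def _ _ X]eq_fun do rewrite big_cons.
exact: is_diffD (fdf i) IH.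
Qed.

Lemma near_eq_diff_app (V W : normedModType R) (f g : V -> W) (x v : V) :
  {near x, f =1 g} -> differentiable f x -> 'd g x v = 'd f x v.
Proof.
by move=> fg df; exact: (congr1 (fun l : V -> W => l v) (near_eq_diff fg df)).
Qed.

Lemma diff_comp_app (U V W : normedModType R) (f : U -> V) (g : V -> W)
    (x v : U) :
  differentiable f x -> differentiable g (f x) ->
  'd (g \o f) x v = 'd g (f x) ('d f x v).
Proof.
by move=> df dg; exact: (congr1 (fun l : U -> W => l v) (diff_comp df dg)).
Qed.

Lemma diff_id_app (V : normedModType R) (x v : V) : 'd (@id V) x v = v.
Proof.
have [_ E] := is_diff_id x.
exact: (congr1 (fun l : V -> V => l v) E).
Qed.

Lemma diff_cst_app (V W : normedModType R) (w : W) (x v : V) :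
  'd (fun=> w) x v = 0.
Proof. exact: (congr1 (fun l : V -> W => l v) (diff_cst w x)). Qed.

(** The base point and the velocities enter through equations, since in use they are known only up
    to rewriting. *)
Lemma diff_comp_pair (V W W' Z : normedModType R) (f : W * W' -> Z)
    (a : V -> W) (b : V -> W') (x v : V) p q u w :
  differentiable a x -> differentiable b x -> differentiable f (p, q) ->
  a x = p -> b x = q -> 'd a x v = u -> 'd b x v = w ->
  'd (fun y => f (a y, b y)) x v = 'd f (p, q) (u, w).
Proof.
move=> da db df ap bq <- <-.
have df' : differentiable f ((fun y => (a y, b y)) x) by rewrite ap bq.
apply: (etrans (diff_comp_app v (differentiable_pair da db) df')).
apply: (etrans (congr1 (fun l : V -> W * W' => 'd f (a x, b x) (l v))
  (diff_pair da db))).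
by rewrite ap bq.
Qed.

(* The term involving the second derivative of [g] vanishes as [g x0] is a    *)
(* critical point of [F].                                                     *)
Lemma diff2_comp_critical a b (A : set 'rV[R]_a) (B : set 'rV[R]_b)
    (g : 'rV[R]_a -> 'rV[R]_b) (F : 'rV[R]_b -> R) x0 v w :
  open A -> A x0 -> (forall x, A x -> B (g x)) -> Ck 2 A g -> Ck 2 B F ->
  (forall u, 'd F (g x0) u = 0) ->
  'd (fun x => 'd (F \o g) x v) x0 w =
  'd (fun y => 'd F y ('d g x0 v)) (g x0) ('d g x0 w).
Proof.
move=> oA Ax0 AB /CkS[dg Dg] /CkS[dF DF] F0.
have dDF u : differentiable (fun y => 'd F y u) (g x0).
  by have /CkS[+ _] := DF u; apply; exact: AB.
have dDg : differentiable (fun x => 'd g x v) x0.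
  by have /CkS[+ _] := Dg v; exact.
have dgi i : is_diff x0 (fun x => 'd g x v 0 i)
    (fun w => 'd (fun x => 'd g x v) x0 w 0 i).
  apply: (diff_comp_linear (l := linear_of (linear_coord (R := R) i))) => //.
  exact: coord_continuous.
have dFg i : is_diff x0 (fun x => 'd F (g x) (delta_mx 0 i))
    (fun w => 'd (fun y => 'd F y (delta_mx 0 i)) (g x0) ('d g x0 w)).
  split; first exact: (differentiable_comp (dg _ Ax0) (dDF _)).
  exact: (diff_comp (dg _ Ax0) (dDF (delta_mx 0 i))).
have nE : {near x0,
    (fun x => \sum_i 'd g x v 0 i *: 'd F (g x) (delta_mx 0 i)) =1
    (fun x => 'd (F \o g) x v)}.
  near=> x; have Ax : A x by near: x; exact: open_nbhs_nbhs.
  rewrite (diff_comp (dg _ Ax) (dF _ (AB _ Ax))) /=.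
  rewrite [in RHS](row_sum_delta ('d g x v)) linear_sum.
  by apply: eq_bigr => i _; rewrite linearZ.
have dS : is_diff x0
    (fun x => \sum_i 'd g x v 0 i *: 'd F (g x) (delta_mx 0 i))
    (fun w => \sum_i 'd g x0 v 0 i *:
       'd (fun y => 'd F y (delta_mx 0 i)) (g x0) ('d g x0 w)).
  apply: is_diff_bigsum => i.
  have [dgi1 dgi2] := dgi i; have [dFg1 dFg2] := dFg i.
  have [dp dpE] := is_diff_scale dgi1 dFg1.
  split=> //; rewrite dpE; apply/funext => u.
  have E1 := congr1 (fun l : 'rV[R]_a -> R => 'd g x0 v 0 i *: l u) dFg2.
  (* The term with the second derivative of [g], whose other factor is [0] by [F0]. *)
  have E2 := congr1 (fun r : R => 'd (fun x => 'd g x v 0 i) x0 u *: r)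
    (F0 (delta_mx 0 i)).
  apply: (etrans (congr2 +%R E1 E2)).
  by cbn beta; rewrite scaler0; exact: addr0.
have [_ ->] := near_eq_is_diff nE dS.
have -> : (fun y => 'd F y ('d g x0 v)) =
    (fun y => \sum_i 'd g x0 v 0 i *: 'd F y (delta_mx 0 i)).
  apply/funext => y; rewrite [in LHS](row_sum_delta ('d g x0 v)) linear_sum.
  by apply: eq_bigr => i _; rewrite linearZ.
have dT : is_diff (g x0)
    (fun y => \sum_i 'd g x0 v 0 i *: 'd F y (delta_mx 0 i))
    (fun u => \sum_i 'd g x0 v 0 i *:
       'd (fun y => 'd F y (delta_mx 0 i)) (g x0) u).
  apply: is_diff_bigsum => i; apply: is_diffZ; exact/differentiableP.
have [_ dTE] := dT.
exact: (esym (congr1 (fun l : 'rV[R]_b -> R => l ('d g x0 w)) dTE)).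
Unshelve. all: by end_near. Qed.

End SecondOrder.

(** * Charts and tangent vectors *)

Section Charts.
Context {R : realType}.

Lemma open_setI_preimage (S T : topologicalType) (A : set S) (B : set T)
    (f : S -> T) :
  open A -> open B -> {in A, continuous f} -> open (A `&` f @^-1` B).
Proof.
move=> oA oB cf; rewrite openE => x [Ax Bfx].
apply: filterI; first exact: open_nbhs_nbhs.
by apply: (cf x (mem_set Ax)); exact: open_nbhs_nbhs.
Qed.

Lemma chart_invK d (M : topologicalType) (c : chart R d M) x :
  chart_cod c x -> chart_dom c (chart_inv c x) /\ c (chart_inv c x) = x.
Proof. by move=> [p cp <-]; rewrite chart_mapK ?inE. Qed.

Lemma chart_codP d (M : topologicalType) (c : chart R d M) p :
  chart_dom c p -> chart_cod c (c p).
Proof. by move=> cp; exists p. Qed.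

Lemma chart_map_invK d (M : topologicalType) (c : chart R d M) p :
  chart_dom c p -> chart_inv c (c p) = p.
Proof. by move=> cp; rewrite chart_mapK ?inE. Qed.

Lemma near_chart_inv d (M : topologicalType) (c : chart R d M) p (B : set M) :
  chart_dom c p -> nbhs p B ->
  \forall x \near c p, chart_cod c x /\ B (chart_inv c x).
Proof.
move=> cp Bp; apply: filterI.
  by apply: open_nbhs_nbhs; split; [exact: chart_cod_open|exact: chart_codP].
apply: (chart_inv_continuous (mem_set (chart_codP cp))).
by rewrite chart_map_invK.
Qed.

Context {d : nat} {M : manifoldType R d}.
Implicit Types (p : M) (c : chart R d M).

Lemma transition_Ck c c' k : atlas c -> atlas c' ->
  Ck k (chart_cod c `&` chart_inv c @^-1` chart_dom c') (c' \o chart_inv c).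
Proof.
move=> ac ac'; apply: (Ck_subset _ (atlas_compat c c' ac ac' k)).
by move=> x [/chart_invK[cx xE] c'x]; exists (chart_inv c x).
Qed.

Lemma transition_differentiable c c' p : atlas c -> atlas c' ->
  chart_dom c p -> chart_dom c' p -> differentiable (c' \o chart_inv c) (c p).
Proof.
move=> ac ac' cp c'p; have /CkS[+ _] := transition_Ck 1 ac ac'; apply.
by split; [exact: chart_codP|rewrite /= chart_map_invK].
Qed.

(** The cocycle rule: near [c p] the two-step transition is the direct one. It makes the family
    built in [tangent_exists] consistent. *)
Lemma transition_diff_comp c c' c'' p u :
  atlas c -> atlas c' -> atlas c'' ->
  chart_dom c p -> chart_dom c' p -> chart_dom c'' p ->
  'd (c'' \o chart_inv c') (c' p) ('d (c' \o chart_inv c) (c p) u) =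
  'd (c'' \o chart_inv c) (c p) u.
Proof.
move=> ac ac' ac'' cp c'p c''p.
have d1 := transition_differentiable ac ac' cp c'p.
have d2 := transition_differentiable ac' ac'' c'p c''p.
have d2' : differentiable (c'' \o chart_inv c') ((c' \o chart_inv c) (c p)).
  by rewrite /= chart_map_invK.
have nE : {near c p, (c'' \o chart_inv c') \o (c' \o chart_inv c) =1
                     c'' \o chart_inv c}.
  have := near_chart_inv cp (open_nbhs_nbhs (conj (chart_dom_open c') c'p)).
  by apply: filterS => x [_ /= c'x]; rewrite (chart_map_invK c'x).
have E := near_eq_diff_app u nE (differentiable_comp d1 d2').
apply: esym; apply: (etrans E); apply: (etrans (diff_comp_app u d1 d2')).
by rewrite /= chart_map_invK.
Qed.

Lemma near_chart_invK c p : chart_dom c p -> {near c p, c \o chart_inv c =1 id}.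
Proof.
move=> cp; near=> x; apply: (chart_invK _).2; near: x.
apply: open_nbhs_nbhs; split; [exact: chart_cod_open|exact: chart_codP].
Unshelve. all: by end_near. Qed.

Lemma tangentP p (v : tangent p) (c c' : chart_at p) :
  v c' = 'd (sval c' \o chart_inv (sval c)) (sval c p) (v c).
Proof. by case: v => v /= /asboolP. Qed.

Lemma tangent_ext p (v w : tangent p) (c : chart_at p) : v c = w c -> v = w.
Proof.
move=> vw; apply: val_inj; apply/funext => c'.
by rewrite /= (tangentP v c) (tangentP w c) vw.
Qed.

Lemma tangent_coordP p (r : R) (v w : tangent p) (c : chart_at p) :
  (r *: v + w) c = r *: v c + w c.
Proof. by []. Qed.

Lemma tangent_exists p (c : chart_at p) (u : 'rV[R]_d) :
  exists v : tangent p, v c = u.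
Proof.
pose v (c' : chart_at p) := 'd (sval c' \o chart_inv (sval c)) (sval c p) u.
have vP : is_tangent v.
  apply/asboolP => c1 c2; rewrite /v.
  have [[ac cp] [ac1 c1p] [ac2 c2p]] := And3 (svalP c) (svalP c1) (svalP c2).
  exact: (esym (transition_diff_comp u ac ac1 ac2 cp c1p c2p)).
exists (Tangent vP); rewrite /= /v.
have idc : differentiable (@id 'rV[R]_d) (sval c p) by exact: ex_diff.
have nE : {near sval c p, id =1 sval c \o chart_inv (sval c)}.
  near=> x; apply/esym; near: x; apply: near_chart_invK.
  by have [] := svalP c.
by apply: (etrans (near_eq_diff_app u nE idc)); rewrite diff_val.
Unshelve. all: by end_near. Qed.

(* All vectors are coordinates of a tangent vector, so that [critical] says   *)
(* that the full differential of the local expression vanishes.               *)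
Lemma critical_diff0 p (f : M -> R) u :
  critical p f ->
  'd (local_expr p f) (sval (some_chart p) p) u = 0.
Proof.
by move=> [_ kp]; have [v <-] := tangent_exists (some_chart p) u; exact: kp.
Qed.

End Charts.

(** * Stabilizers *)

Section Partial.
Context {R : realType} {V W Z : normedModType R}.
Implicit Types (f : V * W -> Z) (x : V) (y : W).

Lemma Ck_id k (A : set V) : Ck k A (@id V).
Proof. by apply: (@Ck_linear_fun R V V k A idfun) => x; exact: cvg_id. Qed.

Lemma differentiable_partial1 f x y : differentiable f (x, y) ->
  differentiable (fun z => f (z, y)) x.
Proof.
by move=> df; exact: (@differentiable_comp _ _ _ _ (fun z => (z, y)) f).
Qed.

Lemma differentiable_partial2 f x y : differentiable f (x, y) ->
  differentiable (fun z => f (x, z)) y.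
Proof.
by move=> df; exact: (@differentiable_comp _ _ _ _ (fun z => (x, z)) f).
Qed.

Lemma diff_partial1 f x y v : differentiable f (x, y) ->
  'd (fun z => f (z, y)) x v = 'd f (x, y) (v, 0).
Proof.
move=> df; apply: (@diff_comp_pair _ _ _ _ _ f id (cst y)) => //.
  exact: diff_id_app.
exact: diff_cst_app.
Qed.

End Partial.

(** * Maps of two variables read in charts *)

Section LocalRepresentation.
Context {R : realType} {a b n : nat} {A : manifoldType R a}
  {B : manifoldType R b} {N : manifoldType R n}.
Variables (F : A -> B -> N) (c : chart R a A) (c' : chart R b B)
  (c'' : chart R n N).

Definition local2 (u : 'rV[R]_a * 'rV[R]_b) : 'rV[R]_n :=
  c'' (F (chart_inv c u.1) (chart_inv c' u.2)).

Definition local2_dom : set ('rV[R]_a * 'rV[R]_b) :=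
  (chart_cod c `*` chart_cod c') `&`
  (fun u => F (chart_inv c u.1) (chart_inv c' u.2)) @^-1` chart_dom c''.

Hypotheses (F_smooth : smooth_map2 F) (ac : atlas c) (ac' : atlas c')
  (ac'' : atlas c'').

Lemma open_local2_dom : open local2_dom.
Proof.
apply: open_setI_preimage; last 2 first.
- exact: chart_dom_open.
- exact: (F_smooth ac ac').1.
rewrite (_ : _ `*` _ = fst @^-1` chart_cod c `&` snd @^-1` chart_cod c')//.
apply: openI; apply: open_comp; try exact: chart_cod_open.
- by move=> u _; exact: cvg_fst.
- by move=> u _; exact: cvg_snd.
Qed.

Lemma local2_Ck k : Ck k local2_dom local2.
Proof. exact: (F_smooth ac ac').2 ac'' k. Qed.

Lemma local2_domP p q : chart_dom c p -> chart_dom c' q ->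
  chart_dom c'' (F p q) -> local2_dom (c p, c' q).
Proof.
move=> cp cq cF; split; first by split; exact: chart_codP.
by rewrite /= !chart_map_invK.
Qed.

Lemma local2E p q : chart_dom c p -> chart_dom c' q ->
  local2 (c p, c' q) = c'' (F p q).
Proof. by move=> cp cq; rewrite /local2 /= !chart_map_invK. Qed.

Lemma local2_differentiable u : local2_dom u -> differentiable local2 u.
Proof. by have /CkS[+ _] := local2_Ck 1; apply. Qed.

Lemma open_local2_slice1 (y : 'rV[R]_b) : open [set x | local2_dom (x, y)].
Proof.
apply: (@open_comp _ _ (fun x => (x, y))) open_local2_dom => x _.
exact: (cvg_pair (@cvg_id _ (nbhs x)) (cvg_cst y)).
Qed.

Lemma open_local2_slice2 (x : 'rV[R]_a) : open [set y | local2_dom (x, y)].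
Proof.
apply: (@open_comp _ _ (fun y => (x, y))) open_local2_dom => y _.
exact: (cvg_pair (cvg_cst x) (@cvg_id _ (nbhs y))).
Qed.

Lemma local2_slice1_Ck k (y : 'rV[R]_b) :
  Ck k [set x | local2_dom (x, y)] (fun x => local2 (x, y)).
Proof.
have b2 := has_finite_basis_prod (has_finite_basis_rV (R := R) a)
  (has_finite_basis_rV (R := R) b).
have oD : open [set x | local2_dom (x, y)] by exact: open_local2_slice1.
apply: (Ck_comp (g := fun x => (x, y)) b2 oD _ _ (local2_Ck k)) => //.
by apply: Ck_pair => //; [exact: Ck_id|exact: Ck_cst].
Qed.

End LocalRepresentation.

Section Stabilizer.
Context {R : realType} {m d : nat} {G : lieGroupType R m}
  {M : manifoldType R d}.
Variables (h : G -> M -> M) (y0 : M).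
Hypothesis h_hom : right_homogeneous h.

Local Notation c0 := (sval (some_chart (1%g : G))).
Local Notation b0 := (sval (some_chart y0)).
Local Notation x0 := (c0 1%g).
Local Notation z0 := (b0 y0).

Definition inv_orbit_map (x : 'rV[R]_m) : 'rV[R]_d :=
  b0 (h (chart_inv c0 x)^-1%g y0).

Let ac0 : atlas c0. Proof. by have [] := svalP (some_chart (1%g : G)). Qed.
Let c01 : chart_dom c0 1%g.
Proof. by have [] := svalP (some_chart (1%g : G)). Qed.
Let ab0 : atlas b0. Proof. by have [] := svalP (some_chart y0). Qed.
Let b0y : chart_dom b0 y0. Proof. by have [] := svalP (some_chart y0). Qed.

Let h_smooth : smooth_map2 h. Proof. by have [] := h_hom. Qed.
Let h1 y : h 1%g y = y. Proof. by have [_ + _ _] := h_hom; exact. Qed.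
Let hM X S y : h (X * S)%g y = h S (h X y).
Proof. by have [_ _ + _] := h_hom; exact. Qed.

(** Inversion followed by the orbit map, both in charts; [D] is where the inverse stays in the chart
    [c0] and its action on [y0] in [b0]. *)
Lemma inv_orbit_map_smooth : exists D : set 'rV[R]_m,
  [/\ open D, D x0, forall k, Ck k D inv_orbit_map &
      forall x, D x -> chart_cod c0 x /\
        chart_dom b0 (h (chart_inv c0 x)^-1%g y0)].
Proof.
have [ci Ci] := lie_inv_smooth (s := G) c0 ac0.
pose Di := chart_cod c0 `&`
  ((fun X : G => X^-1%g) \o chart_inv c0) @^-1` chart_dom c0.
have oDi : open Di.
  by apply: open_setI_preimage => //; [exact: chart_cod_open|
    exact: chart_dom_open].
pose iota x := c0 (chart_inv c0 x)^-1%g.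
have Ciota k : Ck k Di iota by exact: Ci c0 ac0 k.
pose D := Di `&` iota @^-1` [set x | local2_dom h c0 b0 b0 (x, z0)].
have oD : open D.
  apply: open_setI_preimage => //; first exact: open_local2_slice1.
  exact: (Ciota 0%N).
have DE x : D x -> inv_orbit_map x = local2 h c0 b0 b0 (iota x, z0).
  move=> [[_ /= Dx] _]; rewrite /local2 /iota/= !chart_map_invK//.
exists D; split => //.
- split; first by split; [exact: chart_codP|rewrite /= chart_map_invK // invg1].
  rewrite /= /iota chart_map_invK // invg1; apply: local2_domP => //.
  by rewrite h1.
- move=> k; apply: (Ck_eq (f := fun x => local2 h c0 b0 b0 (iota x, z0))) => //.
    by move=> x /set_mem/DE.
  apply: (Ck_comp (g := iota) (has_finite_basis_rV _) oD _ _
    (local2_slice1_Ck h_smooth ac0 ab0 ab0 k z0)).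
    by move=> x [].
  by apply: (Ck_subset _ (Ciota k)) => x [].
- move=> x [[cx /= ix] [_ /= p]]; split => //.
  by move: p; rewrite /= /iota !chart_map_invK.
Qed.

(** Differentiate [h X (h X^-1 y0) = y0] at [1]: the two partial contributions add up to [0], and
    the one through the inner orbit map vanishes by assumption. *)
Lemma diff_inv_orbit_map_eq0 v : 'd inv_orbit_map x0 v = 0 ->
  'd (local2 h c0 b0 b0) (x0, z0) (v, 0) = 0.
Proof.
move=> gv0; have [D [oD Dx0 CD DP]] := inv_orbit_map_smooth.
have g0 : inv_orbit_map x0 = z0.
  by rewrite /inv_orbit_map chart_map_invK // invg1 h1.
have dg : differentiable inv_orbit_map x0.
  by have /CkS[+ _] := CD 1%N; exact.
have deta : differentiable (local2 h c0 b0 b0) (x0, z0).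
  apply: (local2_differentiable h_smooth) => //.
  by apply: local2_domP; rewrite ?h1.
have did : differentiable (@id 'rV[R]_m) x0 by exact: ex_diff.
apply: (etrans (esym (diff_comp_pair did dg deta erefl g0
  (diff_id_app x0 v) gv0))).
have nE : {near x0, cst z0 =1
    (fun x => local2 h c0 b0 b0 (x, inv_orbit_map x))}.
  near=> x; have [cx bx] : chart_cod c0 x /\
      chart_dom b0 (h (chart_inv c0 x)^-1%g y0).
    by apply: DP; near: x; exact: open_nbhs_nbhs.
  by rewrite /local2 /inv_orbit_map /= chart_map_invK // -hM mulVg h1.
apply: (etrans (near_eq_diff_app v nE (differentiable_cst z0 x0))).
exact: diff_cst_app.
Unshelve. all: by end_near. Qed.

(* The integral curves of the right-invariant vector field of a [v] that is   *)
(* killed by the orbit map stay in the stabilizer.                            *)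
Lemma stab_tangent (v : tangent (1%g : G)) :
  'd inv_orbit_map x0 (v (some_chart 1%g)) = 0 ->
  tangent_of (1%g : G) (stab h y0) v.
Proof.
set v0 := v (some_chart 1%g) => gv0.
have mul_smooth : smooth_map2 (fun X Y : G => (X * Y)%g) := lie_mul_smooth.
pose eta := local2 h c0 b0 b0.
pose mu := local2 (fun X Y : G => (X * Y)%g) c0 c0 c0.
pose Deta := local2_dom h c0 b0 b0.
pose Dmu := local2_dom (fun X Y : G => (X * Y)%g) c0 c0 c0.
have deta u : Deta u -> differentiable eta u.
  exact: local2_differentiable h_smooth ac0 ab0 ab0 _.
have dmu u : Dmu u -> differentiable mu u.
  exact: local2_differentiable mul_smooth ac0 ac0 ac0 _.
pose P z := eta (z, z0).
have dP z : Deta (z, z0) -> differentiable P z.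
  by move=> /deta; exact: differentiable_partial1.
have Deta0 : Deta (x0, z0) by apply: local2_domP; rewrite ?h1.
have P0 : P x0 = z0 by rewrite /P /eta local2E// h1.
have dP0 : 'd P x0 v0 = 0.
  exact: etrans (diff_partial1 v0 (deta _ Deta0)) (diff_inv_orbit_map_eq0 gv0).
(* The right-invariant field in the chart: [v0] moved to [x] by the differential of right
   translation. *)
pose V x := 'd mu (x0, x) (v0, 0).
pose A := [set x | Dmu (x0, x)] `&` [set x | Deta (x, z0)].
have oA : open A.
  by apply: openI; [exact: open_local2_slice2|exact: open_local2_slice1].
have Ax0 : A x0 by split => //; apply: local2_domP; rewrite ?mul1g.
have CV k : Ck k A V.
  have /CkS[_ /(_ (v0, 0)) Cmu] := local2_Ck mul_smooth ac0 ac0 ac0 k.+1.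
  have b2 := has_finite_basis_prod (has_finite_basis_rV (R := R) m)
    (has_finite_basis_rV (R := R) m).
  apply: (Ck_comp (g := fun x => (x0, x)) b2 oA _ _ Cmu); first by move=> x [].
  by apply: Ck_pair => //; [exact: Ck_cst|exact: Ck_id].
(* In charts, [h (Z * X) y0 = h X (h Z y0)] says that [P (mu (z, x))] is [eta (x, P z)].
   Differentiating in [z] at [x0] along [v0] gives the claim, as ['d P x0 v0 = 0]. *)
have PV x : A x -> 'd P x (V x) = 0.
  move=> [Dx Px].
  have cx : chart_cod c0 x by case: Dx => -[].
  have mux : mu (x0, x) = x.
    by rewrite /mu /local2 /= chart_map_invK // mul1g (chart_invK cx).2.
  have dmux : differentiable (fun z => mu (z, x)) x0.
    exact: differentiable_partial1 (dmu _ Dx).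
  have dPx : differentiable P (mu (x0, x)) by rewrite mux; exact: dP.
  have detax : differentiable (fun w => eta (x, w)) (P x0).
    by rewrite P0; apply: differentiable_partial2; exact: deta.
  have <- : 'd (P \o (fun z => mu (z, x))) x0 v0 = 'd P x (V x).
    apply: (etrans (diff_comp_app v0 dmux dPx)); rewrite mux.
    by congr ('d P x _); exact: diff_partial1 (dmu _ Dx).
  have nE : {near x0, (fun w => eta (x, w)) \o P =1
                      P \o (fun z => mu (z, x))}.
    have o1 : open [set z | Dmu (z, x)] by exact: open_local2_slice1.
    have o2 : open [set z | Deta (z, z0)] by exact: open_local2_slice1.
    near=> z.
    have [_ /= Dz] : Dmu (z, x) by near: z; exact: open_nbhs_nbhs.
    have [_ /= Pz] : Deta (z, z0) by near: z; exact: open_nbhs_nbhs.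
    rewrite (chart_map_invK b0y) in Pz.
    rewrite /P /eta /mu /local2 /= (chart_map_invK b0y) (chart_map_invK Dz).
    by rewrite (chart_map_invK Pz) hM.
  apply: (etrans (near_eq_diff_app v0 nE
    (differentiable_comp (dP _ Deta0) detax))).
  by apply: (etrans (diff_comp_app v0 (dP _ Deta0) detax)); rewrite dP0 linear0.
have [r r0 [u [u0 du]]] := ode_exists oA Ax0 (CV 1%N).
have I_lt (t : R) : `]-r, r[%classic t -> `|t| < r.
  by rewrite /= in_itv /= ltr_norml.
have Pu (t : R) : `|t| < r -> P (u t) = z0.
  move=> tr.
  have xr (x : R) : x \in `[Num.min 0 t, Num.max 0 t] -> `|x| < r.
    move: tr; rewrite !ltr_norml in_itv /= minEle maxEle.
    move=> /andP[t1 t2] /andP[].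
    by case: ifP => _ x1 x2; apply/andP; split; move: r0; lra.
  have dPu (x : R) : x \in `[Num.min 0 t, Num.max 0 t] ->
      is_derive x 1 (P \o u) ((fun=> 0) x).
    move=> /xr/du[Au dux]; rewrite -(PV _ Au).
    exact: is_derive_comp_diff dux (dP _ Au.2).
  have dPu0 (x : R) : x \in `[Num.min 0 t, Num.max 0 t] ->
    `|(fun=> 0 : 'rV[R]_d) x| <= 0 by rewrite normr0.
  (* A zero derivative bound makes [P \o u] constant, also for negative times. *)
  have := MVT_norm_le_rV (lexx 0) dPu dPu0.
  by rewrite mul0r normr_le0 subr_eq0 /= u0 P0 => /eqP.
exists (chart_inv c0 \o u), r => //.
have cu (t : R) : `|t| < r -> {for t, continuous u}.
  move=> /du[_ [dut _]].
  exact/differentiable_continuous/derivable1_diffP.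
have c0u (t : R) : `|t| < r -> chart_cod c0 (u t).
  by move=> /du[[_ [[]]]].
have oI : open (`]-r, r[%classic : set R) by exact: interval_open.
have cgamma : {in `]-r, r[%classic, continuous (chart_inv c0 \o u)}.
  move=> t /set_mem/I_lt tr; apply: continuous_comp; first exact: cu.
  by apply: chart_inv_continuous; apply/mem_set/c0u.
split.
- split=> // c' ac' k.
  apply: (Ck_comp (has_finite_basis_rV (R := R) m) _ _ _
    (transition_Ck k ac0 ac')).
  + by apply: open_setI_preimage => //; exact: chart_dom_open.
  + by move=> t [/I_lt tr c't]; split; [exact: c0u|].
  + apply: (@Ck_subset _ _ _ _ `]-r, r[%classic); first by move=> t [].
    by apply: (ode_Ck oA oI (CV k)) => t /I_lt/du.
- by rewrite /= u0 chart_map_invK.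
(* [A] keeps the moved point in the domain of [b0], where equal coordinates mean equal points. *)
- move=> t /I_lt tr; have := Pu t tr; have [_ [_ /=]] := (du t tr).1.
  rewrite /P /eta /local2 /stab /= chart_map_invK // => bh bE.
  by rewrite -(chart_map_invK bh) bE chart_map_invK.
- move=> c; have [ac c1] := svalP c.
  have tr0 : `|0 : R| < r by rewrite normr0.
  have dtr : differentiable (sval c \o chart_inv c0) (u 0).
    by rewrite u0; exact: transition_differentiable.
  have [_ dE] := is_derive_comp_diff (du 0 tr0).2 dtr.
  apply: (etrans _ (esym dE)); rewrite u0.
  apply: (etrans (tangentP v (some_chart 1%g) c)).
  congr ('d _ _ _); rewrite -/v0.
  (* The initial velocity [V x0] is [v0], since right translation by [1] is the identity. *)
  have Dx0 := Ax0.1; rewrite /V -(diff_partial1 v0 (dmu _ Dx0)).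
  have nE : {near x0, id =1 (fun z => mu (z, x0))}.
    have nid := near_chart_invK c01.
    near=> z; rewrite /mu /local2 /= chart_map_invK // mulg1; apply/esym.
    by near: z.
  have did := @ex_diff _ _ _ _ _ _ _ (is_diff_id x0).
  apply: esym; apply: (etrans (near_eq_diff_app v0 nE did)).
  exact: diff_id_app.
Unshelve. all: by end_near. Qed.

End Stabilizer.

(** * The cost function *)

Unset Implicit Arguments.

Section CostHessian.
Context {R : realType} {m n : nat} {d : 'I_n -> nat} {G : lieGroupType R m}
  {M : forall i, manifoldType R (d i)}.
Variables (h : forall i, G -> M i -> M i) (y0 : forall i, M i)
  (f : forall i, M i -> R).
Hypotheses (h_hom : forall i, right_homogeneous (h i)).

Local Notation c0 := (sval (some_chart (1%g : G))).
Local Notation x0 := (c0 1%g).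
Local Notation b0 i := (sval (some_chart (y0 i))).
Local Notation g i := (inv_orbit_map (h i) (y0 i)).
Local Notation F i := (local_expr (y0 i) (f i)).
Local Notation phi := (fun X : G => cost h f X y0).

Let g0 i : g i x0 = b0 i (y0 i).
Proof.
have [_ c01] := svalP (some_chart (1%g : G)).
have [_ h1 _ _] := h_hom i.
by rewrite /inv_orbit_map chart_map_invK // invg1 h1.
Qed.

Lemma inv_orbit_continuous i :
  (fun X : G => h i X^-1%g (y0 i)) @ (1%g : G) --> y0 i.
Proof.
have [_ c01] := svalP (some_chart (1%g : G)).
have [_ b0y] := svalP (some_chart (y0 i)).
have [D [oD Dx0 CD DP]] := inv_orbit_map_smooth (y0 i) (h_hom i).
have cc : {for (1%g : G), continuous c0}.
  by apply: chart_map_continuous; exact/mem_set.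
have nE : {near (1%g : G),
    chart_inv (b0 i) \o (g i \o c0) =1 (fun X : G => h i X^-1%g (y0 i))}.
  near=> X.
  have cX : chart_dom c0 X.
    near: X; apply: open_nbhs_nbhs; split=> //; exact: chart_dom_open.
  have [_ bX] : chart_cod c0 (c0 X) /\
      chart_dom (b0 i) (h i (chart_inv c0 (c0 X))^-1%g (y0 i)).
    apply: DP; near: X; apply: cc; exact: open_nbhs_nbhs.
  by rewrite /= /inv_orbit_map chart_map_invK // chart_map_invK.
have : chart_inv (b0 i) \o (g i \o c0) @ (1%g : G) --> y0 i.
  have E : (chart_inv (b0 i) \o (g i \o c0)) 1%g = y0 i.
    by rewrite /= g0 chart_map_invK.
  rewrite -[X in _ --> X]E.
  apply: (@continuous_comp _ _ _ (g i \o c0) (chart_inv (b0 i))).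
    apply: (@continuous_comp _ _ _ c0 (g i)) => //.
    exact: Ck_continuous (CD 0%N) Dx0.
  apply: chart_inv_continuous; rewrite /= g0; apply/mem_set; exact: chart_codP.
by apply: cvg_trans; exact: near_eq_cvg nE.
Unshelve. all: by end_near. Qed.

Hypothesis f_C2 : forall i, Ck_fun 2 (f i).

Let FG_smooth : exists D : 'I_n -> set 'rV[R]_m, forall i,
  [/\ open (D i), D i x0, Ck 2 (D i) (g i),
      (forall x, D i x -> chart_cod (b0 i) (g i x)) &
      forall x, D i x -> f i (h i (chart_inv c0 x)^-1%g (y0 i)) = F i (g i x)].
Proof.
have [D DP] := choice (fun i => inv_orbit_map_smooth (y0 i) (h_hom i)).
exists D => i; have [oD Dx0 CD Db] := DP i; split=> // x /Db[_ bx].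
  exact: chart_codP.
by rewrite /local_expr /inv_orbit_map /= chart_map_invK.
Qed.

Let F_C2 i : Ck 2 (chart_cod (b0 i)) (F i).
Proof. by have [ab _] := svalP (some_chart (y0 i)); exact: f_C2. Qed.

Let FG_C2 D i : open D -> Ck 2 D (g i) ->
  (forall x, D x -> chart_cod (b0 i) (g i x)) -> Ck 2 D (F i \o g i).
Proof.
by move=> oD Cg Dg; exact: Ck_comp (has_finite_basis_rV _) oD Dg Cg (F_C2 i).
Qed.

(** The index set is finite, so one neighborhood of [x0] serves all [i]. *)
Let cost_local : {near x0,
  (fun x => \sum_(i < n) (F i \o g i) x) =1 local_expr (1%g : G) phi}.
Proof.
have [D DP] := FG_smooth.
have : \forall x \near x0, forall i, D i x.
  apply: (@filter_forall _ _ (fun i x => D i x) (nbhs x0) _) => i.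
  by have [oD Dx0 _ _ _] := DP i; exact: open_nbhs_nbhs.
apply: filterS => x Dx; apply: eq_bigr => i _.
by have [_ _ _ _ E] := DP i; rewrite /= -E.
Qed.

Lemma local_cost_is_diff : is_diff x0 (local_expr (1%g : G) phi)
  (fun v => \sum_(i < n) 'd (F i) (b0 i (y0 i)) ('d (g i) x0 v)).
Proof.
apply: near_eq_is_diff cost_local _; have [D DP] := FG_smooth.
apply: is_diff_bigsum => i; have [oD Dx0 Cg Dg _] := DP i.
have dg : differentiable (g i) x0 by have /CkS[+ _] := Cg; exact.
have dF : differentiable (F i) (g i x0).
  by have /CkS[+ _] := F_C2 i; apply; exact: Dg.
split; first exact: (differentiable_comp dg dF).
by apply/funext => v; rewrite -g0; exact: (diff_comp_app v dg dF).
Qed.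

Hypothesis f_crit : forall i, critical (y0 i) (f i).

Lemma critical_cost : critical (1%g : G) phi.
Proof.
have [dphi dphiE] := local_cost_is_diff; split=> // v.
apply: (etrans (congr1 (fun l : 'rV[R]_m -> R => l (v _)) dphiE)).
by apply: big1 => i _; exact: critical_diff0.
Qed.

(** Each summand is the Hessian of [f i] pulled back by the differential of [g i], by
    [diff2_comp_critical] at the critical point [y0 i]. *)
Lemma hess_cost (v w : tangent (1%g : G)) : hess (1%g : G) phi v w =
  \sum_(i < n) 'd (fun y => 'd (F i) y ('d (g i) x0 (v (some_chart 1%g))))
    (b0 i (y0 i)) ('d (g i) x0 (w (some_chart 1%g))).
Proof.
rewrite /hess; set v0 := v _; set w0 := w _.
have [D DP] := FG_smooth.
have nE : {near x0, (fun x => \sum_(i < n) 'd (F i \o g i) x v0) =1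
    (fun x => 'd (local_expr (1%g : G) phi) x v0)}.
  have : \forall x \near x0, forall i, D i x.
    apply: (@filter_forall _ _ (fun i x => D i x) (nbhs x0) _) => i.
    by have [oD Dx0 _ _ _] := DP i; exact: open_nbhs_nbhs.
  move=> nD; near=> x.
  (* The outer derivative compares inner ones at all [x] near [x0], so local agreement is needed
     around each such [x]. *)
  have nx : {near x, (fun x => \sum_(i < n) (F i \o g i) x) =1
      local_expr (1%g : G) phi}.
    by near: x; exact: nbhs_interior cost_local.
  have Dx : forall i, D i x by near: x.
  have dx : is_diff x (fun x => \sum_(i < n) (F i \o g i) x)
      (fun v => \sum_(i < n) 'd (F i \o g i) x v).
    apply: is_diff_bigsum => i; have [oD _ Cg Dg _] := DP i.
    by apply/differentiableP; have /CkS[+ _] := FG_C2 _ _ oD Cg Dg; exact.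
  have [_ E] := near_eq_is_diff nx dx.
  exact: (esym (congr1 (fun l : 'rV[R]_m -> R => l v0) E)).
have dx0 : is_diff x0 (fun x => \sum_(i < n) 'd (F i \o g i) x v0)
    (fun w => \sum_(i < n) 'd (fun x => 'd (F i \o g i) x v0) x0 w).
  apply: is_diff_bigsum => i; have [oD Dx0 Cg Dg _] := DP i.
  apply/differentiableP; have /CkS[_ /(_ v0)] := FG_C2 _ _ oD Cg Dg.
  by move=> /CkS[+ _]; exact.
have [_ E] := near_eq_is_diff nE dx0.
apply: (etrans (congr1 (fun l : 'rV[R]_m -> R => l w0) E)).
apply: eq_bigr => i _; have [oD Dx0 Cg Dg _] := DP i.
have dF0 u : 'd (F i) (g i x0) u = 0 by rewrite g0; exact: critical_diff0.
have E2 := diff2_comp_critical v0 w0 oD Dx0 Dg Cg (F_C2 i) dF0.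
by rewrite g0 in E2; exact: E2.
Unshelve. all: by end_near. Qed.

Hypothesis f_spd : forall i, spd (hess (y0 i) (f i)).
Hypothesis trivial_stab :
  \bigcap_(i in [set: 'I_n]) tangent_of (1%g : G) (stab (h i) (y0 i)) = [set 0].

(** A sum of pullbacks of positive definite forms by the linear maps [T i] vanishes only where every
    [T i v] is [0]; by [stab_tangent] such a [v] is tangent to all the stabilizers. *)
Lemma spd_hess_cost : spd (hess (1%g : G) phi).
Proof.
have Tex (i : 'I_n) : {T : tangent (1%g : G) -> tangent (y0 i) |
    forall v, T v (some_chart (y0 i)) = 'd (g i) x0 (v (some_chart 1%g))}.
  apply: cid.
  have [T TP] := choice (fun v : tangent (1%g : G) =>
    tangent_exists (some_chart (y0 i)) ('d (g i) x0 (v (some_chart 1%g)))).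
  by exists T.
pose T i := sval (Tex i).
have TP i v : T i v (some_chart (y0 i)) = 'd (g i) x0 (v (some_chart 1%g)).
  exact: svalP (Tex i) v.
have hE v w : hess (1%g : G) phi v w =
    \sum_(i < n) hess (y0 i) (f i) (T i v) (T i w).
  rewrite hess_cost; apply: eq_bigr => i _.
  by rewrite /hess !TP.
have T_lin i : linear (T i).
  move=> r v w; apply: (tangent_ext (c := some_chart (y0 i))).
  by rewrite tangent_coordP !TP -linearP tangent_coordP.
split.
- move=> v r w w'; rewrite !hE mulr_sumr -big_split /=.
  by apply: eq_bigr => i _; have [+ _ _ _] := f_spd i; rewrite T_lin; exact.
- move=> w r v v'; rewrite !hE mulr_sumr -big_split /=.
  by apply: eq_bigr => i _; have [_ + _ _] := f_spd i; rewrite T_lin; exact.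
- move=> v w; rewrite !hE; apply: eq_bigr => i _.
  by have [_ _ + _] := f_spd i; exact.
have hess0 i : hess (y0 i) (f i) 0 0 = 0.
  (* Linearity at [-1 *: 0 + 0] reads [H 0 0 = - H 0 0 + H 0 0]. *)
  have [+ _ _ _] := f_spd i => /(_ 0 (-1) 0 0) /=.
  by rewrite scaler0 addr0 mulN1r addNr.
have hess_ge0 i v : 0 <= hess (y0 i) (f i) v v.
  have [->|v0] := eqVneq v 0; first by rewrite hess0.
  by have [_ _ _ /(_ v v0)/ltW] := f_spd i.
move=> v v0; rewrite hE lt_neqAle sumr_ge0 // andbT eq_sym.
apply: contra_neq v0 => /psumr_eq0P h0.
suff : [set 0 : tangent (1%g : G)] v by [].
rewrite -trivial_stab => i _; apply: stab_tangent => //.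
rewrite -TP (_ : T i v = 0) //.
apply/eqP; apply: contraTT isT => Tv0.
have [_ _ _ /(_ _ Tv0)] := f_spd i.
by rewrite h0 // ltxx.
Qed.

End CostHessian.

Theorem proposition6p1 (R : realType) (m : nat) (G : lieGroupType R m)
    (G_connected : connected [set: G])
    (n : nat) (d : 'I_n -> nat) (M : forall i, manifoldType R (d i))
    (h : forall i, G -> M i -> M i)
    (h_hom : forall i, right_homogeneous (h i))
    (y0 : forall i, M i)
    (f : forall i, M i -> R)
    (f_ge0 : forall i y, 0 <= f i y)
    (f_C2 : forall i, Ck_fun 2 (f i)) :
  [/\ (forall (X Z : G) (y : forall i, M i), orbit_of h y0 y ->
         cost h f (X * Z)%g (prod_action h Z y) = cost h f X y),
      ((forall i, locally_posdef (f i) (y0 i)) ->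
       \bigcap_(i in [set: 'I_n]) stab (h i) (y0 i) = [set 1%g] ->
       locally_posdef (fun X : G => cost h f X y0) 1%g) &
      ((forall i, critical (y0 i) (f i)) ->
       critical (1%g : G) (fun X => cost h f X y0) /\
       ((forall i, spd (hess (y0 i) (f i))) ->
        \bigcap_(i in [set: 'I_n]) tangent_of (1%g : G) (stab (h i) (y0 i))
          = [set 0] ->
        spd (hess (1%g : G) (fun X => cost h f X y0))))].
Proof.
split.
- move=> X Z y _; apply: eq_bigr => i _.
  have [_ _ hM _] := h_hom i.
  by rewrite /cost1 /prod_action -hM invgM mulgA mulgV mul1g.
- move=> f_pos stab1.
  have nf : \forall X \near (1%g : G), forall i, 0 <= f i (h i X^-1%g (y0 i)) /\
      (f i (h i X^-1%g (y0 i)) = 0 <-> h i X^-1%g (y0 i) = y0 i).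
    apply: (@filter_forall _ _ (fun i (X : G) => 0 <= f i (h i X^-1%g (y0 i)) /\
      (f i (h i X^-1%g (y0 i)) = 0 <-> h i X^-1%g (y0 i) = y0 i))
      (nbhs (1%g : G)) _) => i.
    have ci := inv_orbit_continuous h y0 h_hom i.
    exact: (ci _ (f_pos i)).
  near=> X.
  have fX : forall i, 0 <= f i (h i X^-1%g (y0 i)) /\
      (f i (h i X^-1%g (y0 i)) = 0 <-> h i X^-1%g (y0 i) = y0 i).
    by near: X.
  split; first by apply: sumr_ge0 => i _; have [] := fX i.
  split=> [|->]; last first.
    apply: big1 => i _; have [_ h1 _ _] := h_hom i.
    apply/(nbhs_singleton nf i).2; by rewrite invg1 h1.
  move=> /psumr_eq0P X0.
  (* The cost evaluates the action at the inverse, so it is [X^-1] that stabilizes every [y0 i]. *)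
  suff X1 : [set 1%g : G] X^-1%g by rewrite -[X]invgK X1 invg1.
  rewrite -stab1 => i _; apply/(fX i).2.
  by apply: X0 => // j _; have [] := fX j.
- move=> f_crit; split; first exact: critical_cost.
  move=> f_spd stab0; exact: spd_hess_cost.
Unshelve. all: by end_near. Qed.
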